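(* Let $K:\mathbb{Z}^2\to(0,\infty)$ satisfy the following assumptions: - $\sup_{k,l\in\mathbb{Z}}K(k,l)\le C_K$ for some $C_K\in(0,\infty)$; - there exists $g:\mathbb{Z}\to(0,\infty)$ with $K(k,l-1)g(k)g(l-1)=K(l,k-1)g(l)g(k-1)$ for all $k,l\in\mathbb{Z}$; - the limits $\Lambda_+:=\lim_{j\to\infty}\frac{K(j,0)}{K(1,j-1)}\in(0,\infty]$ and $\Lambda_-:=\lim_{j\to-\infty}\frac{K(0,j)}{K(j+1,-1)}\in(0,\infty]$ exist and $\big((\Lambda_-\kappa)^{-1},\Lambda_+\kappa\big)\neq\emptyset$, where $\kappa:=\sqrt{K(1,-1)/K(0,0)}$ and $1/\infty:=0$. Let $f_0\in\mathscr{P}_{1,1}$, let $f$ be the corresponding solution of $\dot f(t)=Q(f(t))$, $t>0$, $f(0)=f_0$, and let $f_*\in\mathscr{P}_1$ be a detailed balance equilibrium. Then, for all $0\le s\le t$, $$H(f(t)|f_* )+\int_s^tW(f(\tau))\,d\tau\le H(f(s)|f_* ).$$ Here, the right-hand side or both sides can take the value $\infty$. In particular, if $H(f_0|f_* )<\infty$, then $t\mapsto H(f(t)|f_* )\in[0,\infty)$ is nonincreasing.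
   Context: $\mathscr{P}_1=\{f:\mathbb{Z}\to[0,\infty):\sum_{k\in\mathbb{Z}}f(k)=1\}$ and $\mathscr{P}_{1,1}=\{f\in\mathscr{P}_1:\sum_{k\in\mathbb{Z}}(1+|k|)f(k)<\infty\}$. $\ell_{1,1}(\mathbb{Z})$ is the Banach space of $g:\mathbb{Z}\to\mathbb{R}$ with $\|g\|_{1,1}=\sum_{k}(1+|k|)|g(k)|<\infty$. The collision operator associated with $K$ is $Q(f)=Q(f,f)$, where for $k\in\mathbb{Z}$ $$Q(f,g)(k)=\sum_{l\in\mathbb{Z}}\Big(K(l,k-1)g(l)f(k-1)-K(k,l-1)f(k)g(l-1)-K(l,k)g(l)f(k)+K(k+1,l-1)f(k+1)g(l-1)\Big).$$ For $f_0\in\mathscr{P}_{1,1}$ the initial value problem has a unique global solution $f\in C^1([0,\infty);\ell_{1,1}(\mathbb{Z}))$; it satisfies $f(t)\in\mathscr{P}_{1,1}$ for all $t\ge0$ and $f(t)(k)>0$ for all $t>0$, $k\in\mathbb{Z}$. A detailed balance equilibrium $f_*\in\mathscr{P}_1$ is an $f_*$ with $Q(f_* )=0$ and $K(k,l-1)f_*(k)f_*(l-1)=K(l,k-1)f_*(l)f_*(k-1)$ for all $k,l\in\mathbb{Z}$; necessarily $f_*(k)>0$ for all $k$. Relative entropy: $H(f|g)=\sum_{k\in\mathbb{Z}}f(k)\log\big(f(k)/g(k)\big)\in[0,\infty]$ for $f,g\in\mathscr{P}_1$ with $g>0$, with $0\log0=0$. For $g\in\ell_1(\mathbb{Z})$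 with $g(k)>0$ for all $k$, put $j_{l,k}[g]=K(l,k)g(l)g(k)$ and $$W(g)=\frac12\sum_{k,l\in\mathbb{Z}}\big(j_{l+1,k}[g]-j_{k+1,l}[g]\big)\log\Big(\frac{j_{l+1,k}[g]}{j_{k+1,l}[g]}\Big)\in[0,\infty]$$ (all summands are nonnegative). If $s=0$, the value of $W(f(\tau))$ at the single point $\tau=0$ is irrelevant. *)

(* Defs.v *)
From HB Require Import structures.
From mathcomp Require Import all_boot all_order all_algebra.
From mathcomp Require Import all_classical all_reals all_analysis.
Import Order.TTheory GRing.Theory Num.Theory.
Import numFieldNormedType.Exports.

Set Implicit Arguments.
Unset Strict Implicit.
Unset Printing Implicit Defensive.

Local Open Scope classical_set_scope.
Local Open Scope ring_scope.

(* [esum] is only meaningful for nonnegative summands, so a signed series over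
   the integers is the difference of the sums of its positive and negative
   parts. The value is the expected element of [-oo, +oo] as soon as one of the
   two sums is finite; in particular it is the usual (real) sum of an absolutely
   convergent series. *)
Definition zsum (R : realType) (a : int -> R) : \bar R :=
  (\esum_(k in setT) (EFin \o a)^\+ k - \esum_(k in setT) (EFin \o a)^\- k)%E.

Definition prob1 (R : realType) (f : int -> R) : Prop :=
  (forall k, 0 <= f k) /\ \esum_(k in setT) (f k)%:E = 1%E.

Definition prob11 (R : realType) (f : int -> R) : Prop :=
  prob1 f /\ (\esum_(k in setT) ((1 + `|k|%:~R) * f k)%:E < +oo)%E.

Definition ell11_norm (R : realType) (g : int -> R) : \bar R :=
  \esum_(k in setT) ((1 + `|k|%:~R) * `|g k|)%:E.

Definition ell11 (R : realType) (g : int -> R) : Prop :=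
  (ell11_norm g < +oo)%E.

Definition collision2 (R : realType) (K : int -> int -> R) (f g : int -> R)
    (k : int) : R :=
  fine (zsum (fun l : int =>
      K l (k - 1) * g l * f (k - 1) - K k (l - 1) * f k * g (l - 1)
    - K l k * g l * f k + K (k + 1) (l - 1) * f (k + 1) * g (l - 1))).

Definition collision (R : realType) (K : int -> int -> R) (f : int -> R) :
  int -> R := collision2 K f f.

(* Time-dependent families are indexed by all of R, but only their restriction
   to [0, +oo[ is constrained or used. *)

(* [u] belongs to C^1([0, +oo[; ell_{1,1}(Z)) with derivative [du]: continuity
   and differentiability are with respect to the norm of ell_{1,1}, and limits
   are taken within [0, +oo[, hence one-sided at 0. *)
Definition C1_ell11 (R : realType) (u du : R -> int -> R) : Prop :=
  forall t : R, 0 <= t ->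
    [/\ ell11 (u t), ell11 (du t),
        ell11_norm (fun k => (u s k - u t k) / (s - t) - du t k)
          @[s --> within [set s | 0 <= s] t^'] --> (0 : \bar R)
      & ell11_norm (fun k => du s k - du t k)
          @[s --> within [set s | 0 <= s] (nbhs t)] --> (0 : \bar R)].

Definition is_solution (R : realType) (K : int -> int -> R) (f0 : int -> R)
    (f : R -> int -> R) : Prop :=
  exists df : R -> int -> R,
    [/\ C1_ell11 f df,
        forall t : R, 0 < t -> df t = collision K (f t)
      & f 0 = f0].

Definition detailed_balance (R : realType) (K : int -> int -> R)
    (g : int -> R) : Prop :=
  forall k l : int,
    K k (l - 1) * g k * g (l - 1) = K l (k - 1) * g l * g (k - 1).

Definition is_db_equilibrium (R : realType) (K : int -> int -> R)
    (fs : int -> R) : Prop :=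
  [/\ prob1 fs, forall k, collision K fs k = 0 & detailed_balance K fs].

(* The convention 0 log 0 = 0 holds by absorption. For [f], [g] in P_1 and
   [0 < g] the negative part of the series is summable. *)
Definition rel_entropy (R : realType) (f g : int -> R) : \bar R :=
  zsum (fun k => f k * ln (f k / g k)).

Definition jflux (R : realType) (K : int -> int -> R) (g : int -> R)
    (l k : int) : R := K l k * g l * g k.

Definition dissipation (R : realType) (K : int -> int -> R) (g : int -> R) :
    \bar R :=
  ((2^-1)%:E * \esum_(p in [set: int * int])
     ((jflux K g (p.2 + 1) p.1 - jflux K g (p.1 + 1) p.2) *
       ln (jflux K g (p.2 + 1) p.1 / jflux K g (p.1 + 1) p.2))%:E)%E.

(* Main.v *)
Require Import Defs.
From HB Require Import structures.
From mathcomp Require Import all_boot all_order all_algebra.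
From mathcomp Require Import all_classical all_reals all_analysis measurable_realfun.
From mathcomp Require Import ring lra.
Import Order.TTheory GRing.Theory Num.Theory.
Import numFieldNormedType.Exports.

Set Implicit Arguments.
Unset Strict Implicit.
Unset Printing Implicit Defensive.

Local Open Scope classical_set_scope.
Local Open Scope ring_scope.

(** Idea: Euler's scheme [g := f + h Q(f)] dissipates the relative entropy
    exactly. Let [m] be the equilibrium. The product [f (x) f] describes two
    independent particles; one symmetrized collision step is a Markov kernel
    that is reversible for [m (x) m], and it maps [f (x) f] to a symmetric law
    whose marginal is [g]. Superadditivity of the relative entropy with respect
    to product measures bounds [2 H(g|m)] by the entropy of that law, and
    Jensen's inequality bounds the latter by [2 H(f|m)] minus a sum of Bregman
    distances which is a discrete version of [2 h W(f)].

    Since [Q] is Lipschitz on bounded sets of [ell_1], the scheme converges to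
    the solution as [h -> 0]; in particular the solution stays in [P_1]. Lower
    semicontinuity of the entropy and Fatou's lemma for the step functions in
    time give the inequality in the limit. *)

(** * Absolutely convergent real series *)

(** The formal computation of [dH/dt] is hard to justify directly: [ln (f k / m k)] need not be
    bounded in [k], so the series involved need not converge absolutely. The discrete step needs
    only convexity and sums of nonnegative terms, and its estimates are stated for finite sums,
    whose suprema are taken late. Passing to pairs linearises the problem: on product laws a
    collision is a linear Markov step, and the quadratic nature of [Q] reappears only when a
    marginal is taken. Symmetrizing the kernel makes the two marginals equal, whence the factor 2 on
    both sides. Jensen's inequality yields only one-sided distances [breg a b]. Since [breg a b +
    breg b a = (a - b) * (ln a - ln b)] for positive arguments, and [collide] is an involution
    preserving the collision weight, their weighted sum over all pairs is nevertheless exactly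
    [W]. *)

Section RealSums.
Context {R : realType}.
Implicit Types T : choiceType.

Definition esumT T (a : T -> R) : \bar R := \esum_(k in setT) (a k)%:E.

Definition summ T (a : T -> R) : Prop := (esumT (fun k => `|a k|%R) < +oo)%E.

(* On [int] this is [fine (zsum a)], definitionally. *)
Definition rsum T (a : T -> R) : R :=
  fine (\esum_(k in setT) (EFin \o a)^\+ k - \esum_(k in setT) (EFin \o a)^\- k)%E.

Lemma esumT_ge0 T (a : T -> R) : (forall k, 0 <= a k) -> (0 <= esumT a)%E.
Proof. by move=> a0; apply: esum_ge0 => k _; rewrite lee_fin. Qed.

Lemma le_esumT T (a b : T -> R) : (forall k, a k <= b k) ->
  (esumT a <= esumT b)%E.
Proof. by move=> ab; apply: le_esum => k _; rewrite lee_fin. Qed.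

Lemma esumTD T (a b : T -> R) : (forall k, 0 <= a k) -> (forall k, 0 <= b k) ->
  esumT (fun k => a k + b k) = (esumT a + esumT b)%E.
Proof.
move=> a0 b0; rewrite /esumT -esumD//; last 2 first.
- by move=> i _; rewrite lee_fin.
- by move=> i _; rewrite lee_fin.
Qed.

Lemma esumT_fin T (a : T -> R) : (forall k, 0 <= a k) -> summ a ->
  esumT a \is a fin_num.
Proof.
move=> a0 sa; rewrite ge0_fin_numE; last exact: esumT_ge0.
by apply: le_lt_trans sa; apply: le_esumT => k; rewrite ler_norm.
Qed.

(** Pointwise [a^+ + q = p + a^-], and [a^- <= q] has a finite sum, so both negative parts can be
    subtracted. The sum of [p] may be infinite, as is needed for infinite entropies. *)
Lemma esumT_posneg T (a p q : T -> R) :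
  (forall k, 0 <= p k) -> (forall k, 0 <= q k) ->
  (forall k, a k = p k - q k) -> (esumT q < +oo)%E ->
  (\esum_(k in setT) (EFin \o a)^\+ k - \esum_(k in setT) (EFin \o a)^\- k)%E
  = (esumT p - esumT q)%E.
Proof.
move=> p0 q0 apq qoo.
set ap := esum _ (funepos _); set am := esum _ (funeneg _).
have E1 : (ap + esumT q = esumT p + am)%E.
  rewrite /ap /am /esumT -!esumD.
  - apply: eq_esum => k _; rewrite funeposE funenegE /= -!EFin_max -!EFinD.
    congr (_%:E); rewrite apq; have := p0 k; have := q0 k.
    by rewrite /Num.max; do 2 case: ifPn; lra.
  - by move=> k _; rewrite lee_fin.
  - by move=> k _; exact: funeneg_ge0.
  - by move=> k _; exact: funepos_ge0.
  - by move=> k _; rewrite lee_fin.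
have amq : (am <= esumT q)%E.
  apply: le_esum => k _; rewrite funenegE /= -EFin_max lee_fin apq.
  have := p0 k; have := q0 k.
  by rewrite /Num.max; case: ifPn; lra.
have amf : am \is a fin_num.
  rewrite ge0_fin_numE; first exact: le_lt_trans qoo.
  by apply: esum_ge0 => k _; exact: funeneg_ge0.
have qf : esumT q \is a fin_num by rewrite ge0_fin_numE//; exact: esumT_ge0.
by rewrite -(addeK ap qf) E1 addeAC addeK.
Qed.

Lemma rsum_posneg T (a p q : T -> R) :
  (forall k, 0 <= p k) -> (forall k, 0 <= q k) ->
  (forall k, a k = p k - q k) -> summ p -> summ q ->
  rsum a = fine (esumT p) - fine (esumT q).
Proof.
move=> p0 q0 apq sp sq; rewrite /rsum (esumT_posneg p0 q0 apq).
  by rewrite fineB//; exact: esumT_fin.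
by rewrite -ge0_fin_numE; [exact: esumT_fin|exact: esumT_ge0].
Qed.

Lemma rsum_ge0E T (a : T -> R) : (forall k, 0 <= a k) -> summ a ->
  (rsum a)%:E = esumT a.
Proof.
move=> a0 sa; rewrite (@rsum_posneg _ _ a (fun=> 0))//; last 2 first.
- by move=> k; rewrite subr0.
- by rewrite /summ /esumT esum1// => i _; rewrite normr0.
rewrite [esumT (fun=> 0)]esum1// subr0 fineK//.
exact: esumT_fin.
Qed.

Lemma eq_summ T (a b : T -> R) : a =1 b -> summ a -> summ b.
Proof. by move=> /funext ->. Qed.

Lemma eq_rsum T (a b : T -> R) : a =1 b -> rsum a = rsum b.
Proof. by move=> /funext ->. Qed.

Lemma le_summ T (a b : T -> R) : (forall k, `|a k| <= b k) -> summ b -> summ a.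
Proof.
move=> ab; apply: le_lt_trans; apply: le_esumT => k.
by rewrite (le_trans (ab k))// ler_norm.
Qed.

Lemma summ_norm T (a : T -> R) : summ a -> summ (fun k => `|a k|).
Proof. by apply: le_lt_trans; apply: le_esumT => k; rewrite normr_id. Qed.

Lemma summD T (a b : T -> R) : summ a -> summ b -> summ (fun k => a k + b k).
Proof.
move=> sa sb; apply: (@le_summ _ _ (fun k => `|a k| + `|b k|)) => [k|].
  exact: ler_normD.
rewrite /summ -(_ : (fun k => `|a k| + `|b k|) = fun k => `| `|a k| + `|b k| |).
  by rewrite esumTD// lte_add_pinfty.
by apply/funext => k; rewrite [RHS]ger0_norm ?addr_ge0.
Qed.

Lemma summN T (a : T -> R) : summ a -> summ (fun k => - a k).
Proof. by apply: le_lt_trans; apply: le_esumT => k; rewrite normrN. Qed.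

Lemma summB T (a b : T -> R) : summ a -> summ b -> summ (fun k => a k - b k).
Proof. by move=> sa sb; exact: summD sa (summN sb). Qed.

Lemma summ_split T (a : T -> R) : summ a -> exists p q : T -> R,
  [/\ forall k, 0 <= p k, forall k, 0 <= q k, forall k, a k = p k - q k,
      summ p & summ q].
Proof.
move=> sa; exists (fun k => Num.max (a k) 0), (fun k => Num.max (- a k) 0).
split.
- by move=> k; rewrite le_max lexx orbT.
- by move=> k; rewrite le_max lexx orbT.
- by move=> k; rewrite /Num.max; do 2 case: ifPn; lra.
- apply: le_summ (summ_norm sa) => k.
  by rewrite ger0_norm ?ge_max ?ler_norm ?normr_ge0// le_max lexx orbT.
- apply: le_summ (summ_norm sa) => k.
  rewrite ger0_norm ?ge_max ?normr_ge0 ?le_max ?lexx ?orbT//.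
  by rewrite -normrN ler_norm.
Qed.

Lemma summ0 T : summ (fun _ : T => 0 : R).
Proof. by rewrite /summ /esumT esum1// => k _; rewrite normr0. Qed.

Lemma rsum0 T : rsum (fun _ : T => 0 : R) = 0.
Proof. by apply: EFin_inj; rewrite rsum_ge0E ?/esumT ?esum1//; exact: summ0. Qed.

Lemma rsumD T (a b : T -> R) : summ a -> summ b ->
  rsum (fun k => a k + b k) = rsum a + rsum b.
Proof.
move=> /summ_split[p [q [p0 q0 apq sp sq]]] /summ_split[p' [q' [p'0 q'0 bpq sp' sq']]].
rewrite (@rsum_posneg _ _ (fun k => p k + p' k) (fun k => q k + q' k)).
- rewrite (rsum_posneg p0 q0 apq sp sq) (rsum_posneg p'0 q'0 bpq sp' sq').
  by rewrite !esumTD// !fineD ?esumT_fin//; lra.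
- by move=> k; rewrite addr_ge0.
- by move=> k; rewrite addr_ge0.
- by move=> k; rewrite apq bpq; lra.
- exact: summD.
- exact: summD.
Qed.

Lemma rsumN T (a : T -> R) : summ a -> rsum (fun k => - a k) = - rsum a.
Proof.
move=> /summ_split[p [q [p0 q0 apq sp sq]]].
rewrite (@rsum_posneg _ _ q p)// ?(rsum_posneg p0 q0 apq sp sq) ?opprB//.
by move=> k; rewrite apq opprB.
Qed.

Lemma rsumB T (a b : T -> R) : summ a -> summ b ->
  rsum (fun k => a k - b k) = rsum a - rsum b.
Proof. by move=> sa sb; rewrite rsumD ?rsumN//; exact: summN. Qed.

Lemma rsum_ge0 T (a : T -> R) : (forall k, 0 <= a k) -> summ a -> 0 <= rsum a.
Proof. by move=> a0 sa; rewrite -lee_fin rsum_ge0E// esumT_ge0. Qed.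

Lemma le_rsum T (a b : T -> R) : (forall k, a k <= b k) -> summ a -> summ b ->
  rsum a <= rsum b.
Proof.
move=> ab sa sb; rewrite -subr_ge0 -rsumB//; apply: rsum_ge0; last exact: summB.
by move=> k; rewrite subr_ge0.
Qed.

Lemma ler_norm_rsum T (a : T -> R) : summ a -> `|rsum a| <= rsum (fun k => `|a k|).
Proof.
move=> sa; rewrite ler_norml -rsumN; last exact: summ_norm.
by rewrite !le_rsum//; try (by move=> k; rewrite ?ler_norm// lerNl -normrN ler_norm);
   try exact: summN (summ_norm sa); exact: summ_norm.
Qed.

Lemma sum_le_esumT T (a : T -> R) (s : seq T) : (forall k, 0 <= a k) -> uniq s ->
  ((\sum_(k <- s) a k)%:E <= esumT a)%E.
Proof.
move=> a0 us; apply: esum_ge; exists [set` s]; first by split => //; exact: finite_seq.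
by rewrite -fsbig_seq// sumEFin.
Qed.

Lemma sum_le_rsum T (a : T -> R) (s : seq T) : (forall k, 0 <= a k) -> summ a ->
  uniq s -> \sum_(k <- s) a k <= rsum a.
Proof. by move=> a0 sa us; rewrite -lee_fin rsum_ge0E//; exact: sum_le_esumT. Qed.

Lemma esumT_le T (a : T -> R) (M : \bar R) :
  (forall s : seq T, uniq s -> ((\sum_(k <- s) a k)%:E <= M)%E) ->
  (esumT a <= M)%E.
Proof.
move=> H; apply: ge_ereal_sup => _ [X [finX _]] <-.
by rewrite fsbig_finite//= sumEFin H.
Qed.

Lemma summ_bounded T (a : T -> R) (M : R) :
  (forall s : seq T, uniq s -> \sum_(k <- s) `|a k| <= M) -> summ a.
Proof.
move=> H; apply: (@le_lt_trans _ _ M%:E); last exact: ltry.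
by apply: esumT_le => s us; rewrite lee_fin H.
Qed.

Lemma rsum_le T (a : T -> R) (M : R) : (forall k, 0 <= a k) -> summ a ->
  (forall s : seq T, uniq s -> \sum_(k <- s) a k <= M) -> rsum a <= M.
Proof.
move=> a0 sa H; rewrite -lee_fin rsum_ge0E//.
by apply: esumT_le => s us; rewrite lee_fin H.
Qed.

Lemma le1_rsum T (a : T -> R) k : (forall k, 0 <= a k) -> summ a -> a k <= rsum a.
Proof.
by move=> a0 sa; have := @sum_le_rsum _ a [:: k] a0 sa; rewrite big_seq1; exact.
Qed.

Lemma summZ T (c : R) (a : T -> R) : summ a -> summ (fun k => c * a k).
Proof.
move=> sa; apply: (@summ_bounded _ _ (`|c| * rsum (fun k => `|a k|))) => s us.
under eq_bigr do rewrite normrM.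
rewrite -mulr_sumr ler_wpM2l// sum_le_rsum//; exact: summ_norm.
Qed.

Lemma rsumZ_ge0 T (c : R) (a : T -> R) : 0 <= c -> (forall k, 0 <= a k) ->
  summ a -> rsum (fun k => c * a k) = c * rsum a.
Proof.
move=> c0 a0 sa; apply: EFin_inj; rewrite EFinM !rsum_ge0E//.
- have [->|cn0] := eqVneq c 0.
    rewrite mul0e; apply: esum1 => k _; by rewrite mul0r.
  have {cn0}c0 : 0 < c by rewrite lt_def cn0.
  apply/eqP; rewrite eq_le; apply/andP; split.
    apply: esumT_le => s us; rewrite -mulr_sumr EFinM lee_pmul2l//.
    exact: sum_le_esumT.
  rewrite muleC -lee_pdivlMr//; apply: esumT_le => s us.
  rewrite lee_pdivlMr// muleC -EFinM mulr_sumr; apply: sum_le_esumT => // k.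
  by rewrite mulr_ge0// ltW.
- by move=> k; rewrite mulr_ge0.
- exact: summZ.
Qed.

Lemma rsumZ T (c : R) (a : T -> R) : summ a ->
  rsum (fun k => c * a k) = c * rsum a.
Proof.
wlog c0 : c / 0 <= c => [wl sa|].
  case: (leP 0 c) => [|/ltW c0]; first by move=> /wl; exact.
  rewrite -[RHS]opprK -mulNr -wl ?oppr_ge0// -rsumN; last exact: summZ.
  by apply: eq_rsum => k; rewrite mulNr opprK.
move=> /summ_split[p [q [p0 q0 apq sp sq]]].
rewrite (eq_rsum apq) rsumB// mulrBr -!rsumZ_ge0// -rsumB; try exact: summZ.
by apply: eq_rsum => k; rewrite apq mulrBr.
Qed.

Lemma reindex_summ (T T' : choiceType) (e : T -> T') (a : T' -> R) :
  bijective e -> summ (a \o e) <-> summ a.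
Proof.
by rewrite -setTT_bijective => be; rewrite /summ /esumT (reindex_esum _ _ _ _ be).
Qed.

Lemma reindex_rsum (T T' : choiceType) (e : T -> T') (a : T' -> R) :
  bijective e -> rsum (a \o e) = rsum a.
Proof.
rewrite -setTT_bijective => be; rewrite /rsum; congr fine.
rewrite (reindex_esum _ _ _ (funepos (EFin \o a)) be).
rewrite (reindex_esum _ _ _ (funeneg (EFin \o a)) be).
by congr (_ - _)%E; apply: eq_esum => k _; rewrite ?funeposE ?funenegE.
Qed.

Section Product.
Variables T T' : choiceType.

Lemma esumT_pair (a : T * T' -> R) : (forall x, 0 <= a x) ->
  esumT a = \esum_(k in setT) esumT (fun l => a (k, l)).
Proof.
move=> a0; rewrite /esumT esum_esum/=; last by move=> *; rewrite lee_fin.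
rewrite (_ : _ `*`` _ = setT); last by apply/seteqP; split.
by apply: eq_esum => -[].
Qed.

Lemma summ_section (a : T * T' -> R) k : summ a -> summ (fun l => a (k, l)).
Proof.
move=> sa; apply: (@summ_bounded _ _ (rsum (fun x => `|a x|))) => s us.
rewrite (_ : \sum_(l <- s) _ = \sum_(x <- [seq (k, l) | l <- s]) `|a x|).
  apply: sum_le_rsum => //; first exact: summ_norm.
  by rewrite map_inj_uniq// => x y [].
by rewrite big_map.
Qed.

Lemma rsum_pair_ge0 (a : T * T' -> R) : (forall x, 0 <= a x) -> summ a ->
  summ (fun k => rsum (fun l => a (k, l))) /\
  rsum (fun k => rsum (fun l => a (k, l))) = rsum a.
Proof.
move=> a0 sa; have r0 k : 0 <= rsum (fun l => a (k, l)).
  by apply: rsum_ge0 => //; exact: summ_section.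
have E : esumT (fun k => rsum (fun l => a (k, l))) = esumT a.
  rewrite esumT_pair//; apply: eq_esum => k _; rewrite rsum_ge0E//.
  exact: summ_section.
have s : summ (fun k => rsum (fun l => a (k, l))).
  rewrite /summ (_ : esumT _ = esumT a) ?esumT_fin//.
    by rewrite -ge0_fin_numE ?esumT_fin// esumT_ge0.
  by rewrite -E; congr esumT; apply/funext => k; rewrite ger0_norm.
by split => //; apply: EFin_inj; rewrite !rsum_ge0E.
Qed.

Lemma rsum_pair (a : T * T' -> R) : summ a ->
  rsum (fun k => rsum (fun l => a (k, l))) = rsum a.
Proof.
move=> /summ_split[p [q [p0 q0 apq sp sq]]].
have [sp' ep] := rsum_pair_ge0 p0 sp; have [sq' eq] := rsum_pair_ge0 q0 sq.
rewrite [RHS](eq_rsum apq) rsumB// -ep -eq -rsumB//.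
apply: eq_rsum => k; rewrite -rsumB; try exact: summ_section.
exact: eq_rsum.
Qed.

Lemma summ_pairM (a : T -> R) (b : T' -> R) : summ a -> summ b ->
  summ (fun x : T * T' => a x.1 * b x.2).
Proof.
move=> sa sb; rewrite /summ esumT_pair//.
pose A := rsum (fun k => `|a k|); pose B := rsum (fun k => `|b k|).
rewrite (_ : \esum_(k in _) _ = (B * A)%:E); first exact: ltry.
rewrite -rsumZ; last exact: summ_norm.
rewrite rsum_ge0E; last 2 first.
- by move=> k; rewrite mulr_ge0// rsum_ge0//; exact: summ_norm.
- exact/summZ/summ_norm.
apply: eq_esum => k _; rewrite mulrC -rsumZ; last exact: summ_norm.
rewrite rsum_ge0E; last 2 first.
- by move=> l; rewrite mulr_ge0.
- exact/summZ/summ_norm.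
by apply: eq_esum => l _; rewrite normrM.
Qed.

Lemma rsum_pairM (a : T -> R) (b : T' -> R) : summ a -> summ b ->
  rsum (fun x : T * T' => a x.1 * b x.2) = rsum a * rsum b.
Proof.
move=> sa sb; rewrite -rsum_pair/=; last exact: summ_pairM.
by under eq_rsum do rewrite rsumZ//; rewrite mulrC -rsumZ//; apply: eq_rsum => k; rewrite mulrC.
Qed.

End Product.

End RealSums.

(** * The collision operator on ell_1 *)

Section Collision.
Context {R : realType}.

Definition norm1 (T : choiceType) (f : T -> R) : R := rsum (fun k => `|f k|).

Lemma norm1_ge0 (T : choiceType) (f : T -> R) : summ f -> 0 <= norm1 f.
Proof. by move=> sf; apply: rsum_ge0 => //; exact: summ_norm. Qed.

Lemma norm1D (T : choiceType) (f g : T -> R) : summ f -> summ g ->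
  norm1 (fun k => f k + g k) <= norm1 f + norm1 g.
Proof.
move=> sf sg; rewrite /norm1 -rsumD; try exact: summ_norm.
apply: le_rsum => [k| |]; first exact: ler_normD.
- exact/summ_norm/summD.
- by apply: summD; exact: summ_norm.
Qed.

Lemma norm1N (T : choiceType) (f : T -> R) :
  norm1 (fun k => - f k) = norm1 f.
Proof. by apply: eq_rsum => k; rewrite normrN. Qed.

Lemma norm1B (T : choiceType) (f g : T -> R) : summ f -> summ g ->
  norm1 (fun k => f k - g k) <= norm1 f + norm1 g.
Proof. by move=> sf sg; rewrite -(norm1N g) norm1D//; exact: summN. Qed.

Lemma norm1Z (T : choiceType) (c : R) (f : T -> R) : summ f ->
  norm1 (fun k => c * f k) = `|c| * norm1 f.
Proof.
move=> sf; rewrite /norm1 -rsumZ; last exact: summ_norm.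
by apply: eq_rsum => k; rewrite normrM.
Qed.

Lemma ler_norm1 (T : choiceType) (f : T -> R) k : summ f -> `|f k| <= norm1 f.
Proof. by move=> sf; apply: (le1_rsum (a := fun k => `|f k|)) => //; exact: summ_norm. Qed.

Lemma ge0_norm1 (T : choiceType) (f : T -> R) :
  (forall k, 0 <= f k) -> norm1 f = rsum f.
Proof. by move=> f0; apply: eq_rsum => k; rewrite ger0_norm. Qed.

Lemma bij_addz (c : int) : bijective (fun k : int => k + c).
Proof. by exists (fun k => k - c) => k; rewrite ?addrK ?subrK. Qed.

Lemma summ_shift (c : int) (f : int -> R) : summ f -> summ (fun k => f (k + c)).
Proof. by move=> sf; apply/(reindex_summ f (bij_addz c)). Qed.

Lemma rsum_shift (c : int) (f : int -> R) : rsum (fun k => f (k + c)) = rsum f.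
Proof. exact: (reindex_rsum f (bij_addz c)). Qed.

Lemma norm1_shift (c : int) (f : int -> R) : norm1 (fun k => f (k + c)) = norm1 f.
Proof. exact: (rsum_shift c (fun k => `|f k|)). Qed.

Section Flux.
Variables (J : int -> int -> R) (C : R).
Hypothesis J_le : forall l k, `|J l k| <= C.

(** For [J = K] this is the rate at which a particle at [k] is raised to [k + 1]; for the transposed
    kernel, the rate at which it is lowered to [k - 1]. The collision operator is a signed sum of
    four shifted fluxes. *)
Definition rate (f : int -> R) (k : int) : R := rsum (fun l => J l k * f l).
Definition flux (f : int -> R) (k : int) : R := rate f k * f k.

Let C_ge0 : 0 <= C.
Proof. exact: le_trans (normr_ge0 _) (J_le 0 0). Qed.

Lemma summ_rate f k : summ f -> summ (fun l => J l k * f l).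
Proof.
move=> sf; apply: le_summ (summZ C (summ_norm sf)) => l.
by rewrite normrM ler_wpM2r.
Qed.

Lemma rate_le f k : summ f -> `|rate f k| <= C * norm1 f.
Proof.
move=> sf; apply: le_trans (ler_norm_rsum (summ_rate k sf)) _.
rewrite -rsumZ; last exact: summ_norm.
apply: le_rsum => [l| |]; first by rewrite normrM ler_wpM2r.
- exact/summ_norm/summ_rate.
- exact/summZ/summ_norm.
Qed.

Lemma rateB f g k : summ f -> summ g ->
  rate f k - rate g k = rate (fun l => f l - g l) k.
Proof.
move=> sf sg; rewrite /rate -rsumB; try exact: summ_rate.
by apply: eq_rsum => l; rewrite mulrBr.
Qed.

Lemma summ_flux f : summ f -> summ (flux f).
Proof.
move=> sf; apply: le_summ (summZ (C * norm1 f) (summ_norm sf)) => k.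
by rewrite normrM ler_wpM2r// rate_le.
Qed.

Lemma fluxB_le f g : summ f -> summ g ->
  norm1 (fun k => flux f k - flux g k) <=
  C * (norm1 f + norm1 g) * norm1 (fun k => f k - g k).
Proof.
move=> sf sg; have sfg := summB sf sg.
have -> : C * (norm1 f + norm1 g) * norm1 (fun k => f k - g k) =
   rsum (fun k => C * norm1 (fun k => f k - g k) * `|f k| +
                  C * norm1 g * `|f k - g k|).
  have s1 := summ_norm sf; have s2 := summ_norm sfg.
  rewrite rsumD; try exact: summZ.
  by rewrite !rsumZ// -/(norm1 f) -/(norm1 (fun k => f k - g k)); ring.
apply: le_rsum => [k| |].
- have -> : flux f k - flux g k =
     (rate f k - rate g k) * f k + rate g k * (f k - g k).
    by rewrite /flux; ring.
  rewrite (le_trans (ler_normD _ _))// !normrM lerD// ler_wpM2r//.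
    by rewrite rateB// rate_le.
  by rewrite rate_le.
- by apply/summ_norm/summB; exact: summ_flux.
- by apply: summD; apply: summZ; exact: summ_norm.
Qed.

End Flux.

Variables (K : int -> int -> R) (C : R).
Hypothesis K_le : forall k l, `|K k l| <= C.
Let K' l k := K k l.
Let K'_le : forall k l, `|K' k l| <= C.
Proof. by move=> k l; exact: K_le. Qed.

Lemma collisionE f k : summ f -> collision K f k =
  flux K f (k - 1) - flux (fun l k => K k l) f k - flux K f k
   + flux (fun l k => K k l) f (k + 1).
Proof.
move=> sf; have sf1 := summ_shift (-1) sf.
have s1 := summ_rate K_le (k - 1) sf.
have s3 := summ_rate K_le k sf.
have s2 := summ_shift (-1) (summ_rate K'_le k sf).
have s4 := summ_shift (-1) (summ_rate K'_le (k + 1) sf).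
transitivity (rsum (fun l => f (k - 1) * (K l (k - 1) * f l)
  - f k * (K' (l - 1) k * f (l - 1)) - f k * (K l k * f l)
  + f (k + 1) * (K' (l - 1) (k + 1) * f (l - 1)))).
  rewrite /collision /collision2 -/(rsum _); apply: eq_rsum => l; rewrite /K'; ring.
have t1 := summZ (f (k - 1)) s1; have t2 := summZ (f k) s2.
have t3 := summZ (f k) s3; have t4 := summZ (f (k + 1)) s4.
rewrite rsumD//; last by apply: summB => //; exact: summB.
rewrite rsumB//; last exact: summB.
rewrite rsumB// !rsumZ// /flux /rate.
rewrite (rsum_shift (-1) (fun l => K' l k * f l)).
rewrite (rsum_shift (-1) (fun l => K' l (k + 1) * f l)) /K'.
ring.
Qed.

Lemma summ_collision f : summ f -> summ (collision K f).
Proof.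
move=> sf; apply: (eq_summ (fun k => esym (collisionE k sf))).
have s1 := summ_flux K_le sf; have s2 := summ_flux K'_le sf.
apply: summD; last exact: (summ_shift 1 s2).
by apply: summB => //; apply: summB => //; exact: (summ_shift (-1) s1).
Qed.

Lemma rsum_collision f : summ f -> rsum (collision K f) = 0.
Proof.
move=> sf; rewrite (eq_rsum (fun k => collisionE k sf)).
have s1 := summ_flux K_le sf; have s2 := summ_flux K'_le sf.
have s1' := summ_shift (-1) s1; have s2' := summ_shift 1 s2.
have s3 := summB s1' s2.
rewrite rsumD//; last exact: summB.
rewrite rsumB// rsumB// (rsum_shift (-1) (flux K f)) (rsum_shift 1 (flux K' f)).
by rewrite /K'; ring.
Qed.

(** Shifts are isometries of ell_1, so each of the four fluxes contributes its own Lipschitz bound,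
    hence the factor 4. *)
Lemma collisionB_le f g : summ f -> summ g ->
  norm1 (fun k => collision K f k - collision K g k) <=
  4 * C * (norm1 f + norm1 g) * norm1 (fun k => f k - g k).
Proof.
move=> sf sg.
pose d J k : R := flux J f k - flux J g k.
have s1 : summ (d K) by apply: summB; exact: (summ_flux K_le).
have s2 : summ (d K') by apply: summB; exact: (summ_flux K'_le).
have s1' := summ_shift (-1) s1; have s2' := summ_shift 1 s2.
have s3 := summB s1' s2; have s4 := summB s3 s1.
rewrite (_ : (fun k => _) =
    fun k => d K (k - 1) - d K' k - d K k + d K' (k + 1)); last first.
  by apply/funext => k; rewrite !collisionE// /d /K'; ring.
have H1 := fluxB_le K_le sf sg; have H2 := fluxB_le K'_le sf sg.
apply: le_trans (norm1D s4 s2') _.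
have := norm1B s3 s1; have := norm1B s1' s2.
rewrite (norm1_shift (-1) (d K)) (norm1_shift 1 (d K')).
rewrite -/(d K) -/(d K') in H1 H2.
by move: H1 H2; rewrite -/(norm1 _); nra.
Qed.

Lemma collision_le f : summ f -> norm1 (collision K f) <= 4 * C * norm1 f ^+ 2.
Proof.
move=> sf.
have s0 := @summ0 R int.
have n0 : norm1 (fun _ : int => 0 : R) = 0.
  by rewrite /norm1 -[RHS](@rsum0 _ int); apply: eq_rsum => k; rewrite normr0.
have := collisionB_le sf s0; rewrite n0 addr0.
have -> : (fun k => collision K f k - collision K (fun=> 0) k) = collision K f.
  by apply/funext => k; rewrite (collisionE k s0) /flux !mulr0; ring.
have -> : (fun k => f k - 0) = f by apply/funext => k; rewrite subr0.
by rewrite expr2 mulrA.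
Qed.

End Collision.

(** * Superadditivity of the relative entropy *)

Section Entropy.
Context {R : realType}.

(** The affine correction makes [phi] nonnegative without changing the entropy: for [g] and [m] of
    equal mass, the sum of [m k * phi (g k / m k)] is the relative entropy. *)
Definition phi (a : R) : R := a * ln a - a + 1.

(* The Bregman distance of [phi]; its junk value [0] when [a] or [b] vanishes
   matches the junk values of [ln] and of the division in [dissipation]. *)
Definition breg (a b : R) : R :=
  if (0 < a) && (0 < b) then a * (ln a - ln b) - a + b else 0.

Lemma ln_leB1 (x : R) : 0 < x -> ln x <= x - 1.
Proof.
move=> x0; have := @le_ln1Dx R (x - 1).
by rewrite (_ : 1 + (x - 1) = x); [apply; lra|ring].
Qed.

Lemma breg_ge0 a b : 0 <= breg a b.
Proof.
rewrite /breg; case: ifP => // /andP[a0 b0].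
have := ln_leB1 (divr_gt0 b0 a0); rewrite ln_div ?posrE// => H.
have := ler_wpM2l (ltW a0) H; rewrite !mulrBr mulrCA divff ?gt_eqF// ?mulr1; lra.
Qed.

Lemma phi0 : phi 0 = 1.
Proof. by rewrite /phi mul0r subr0 add0r. Qed.

(** For [a > 0] this is an equality, [breg a v] being the gap between [phi] and its tangent at [v].
    At [a = 0] the true gap is [v], while [breg] has its default value 0. *)
Lemma phi_tangent v a : 0 < v -> 0 <= a ->
  phi v + ln v * (a - v) + breg a v <= phi a.
Proof.
move=> v0; rewrite le_eqVlt => /predU1P[<-|a0].
  by rewrite /breg ltxx /= phi0 /phi; lra.
by rewrite /breg a0 v0 /= /phi; lra.
Qed.

Lemma phi_ge0 a : 0 <= a -> 0 <= phi a.
Proof.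
move=> a0; have := @phi_tangent 1 a ltr01 a0; have := breg_ge0 a 1.
by rewrite /phi ln1; lra.
Qed.

(** The Fenchel-Young inequality: the convex conjugate of [phi] is [expR y - 1], taken at
    [y = ln w]. The last condition replaces the value minus infinity of the logarithm at 0, where
    [ln] is 0. *)
Lemma phi_young v w : 0 <= v -> 0 <= w -> (w = 0 -> v = 0) ->
  v * ln w <= phi v + w - 1.
Proof.
move=> v0; rewrite le_eqVlt => /predU1P[<-/(_ erefl) ->|w0 _].
  by rewrite phi0; lra.
have := @phi_tangent w v w0 v0; have := breg_ge0 v w.
by rewrite /phi; lra.
Qed.

(** Average the three tangent inequalities at the mean [v]: the linear terms cancel. The gap of
    [a1], the case without collision, is dropped; the other two become the dissipation. *)
Lemma phi_jensen p1 p2 p3 a1 a2 a3 v : 0 < p1 -> 0 < p2 -> 0 < p3 ->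
  p1 + p2 + p3 = 1 -> 0 <= a1 -> 0 <= a2 -> 0 <= a3 ->
  v = p1 * a1 + p2 * a2 + p3 * a3 ->
  phi v + p2 * breg a2 v + p3 * breg a3 v <=
  p1 * phi a1 + p2 * phi a2 + p3 * phi a3.
Proof.
move=> p10 p20 p30 p1E a10 a20 a30 vE.
have m1 : 0 <= p1 * a1 by rewrite mulr_ge0// ltW.
have m2 : 0 <= p2 * a2 by rewrite mulr_ge0// ltW.
have m3 : 0 <= p3 * a3 by rewrite mulr_ge0// ltW.
have : 0 <= v by rewrite vE !addr_ge0.
rewrite le_eqVlt => /predU1P[v0|v0].
  have a1E : a1 = 0 by apply: (mulfI (lt0r_neq0 p10)); lra.
  have a2E : a2 = 0 by apply: (mulfI (lt0r_neq0 p20)); lra.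
  have a3E : a3 = 0 by apply: (mulfI (lt0r_neq0 p30)); lra.
  by rewrite -v0 a1E a2E a3E phi0 /breg ltxx/=; lra.
have t1 := phi_tangent v0 a10; have t2 := phi_tangent v0 a20.
have t3 := phi_tangent v0 a30; have b1 := breg_ge0 a1 v.
have {}t1 : phi v + ln v * (a1 - v) <= phi a1 by lra.
have {}t1 := ler_wpM2l (ltW p10) t1.
have {}t2 := ler_wpM2l (ltW p20) t2.
have {}t3 := ler_wpM2l (ltW p30) t3.
have : p1 * (phi v + ln v * (a1 - v)) + p2 * (phi v + ln v * (a2 - v) + breg a2 v)
  + p3 * (phi v + ln v * (a3 - v) + breg a3 v) =
  (p1 + p2 + p3) * phi v + ln v * (v - (p1 + p2 + p3) * v) +
  p2 * breg a2 v + p3 * breg a3 v by rewrite [X in ln v * (X - (p1 + p2 + p3) * v)]vE; ring.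
rewrite p1E; lra.
Qed.

(** This makes the entropy additive on products: summed against [m (x) m], the defect
    [(a - 1) * (b - 1)] vanishes for densities of probability vectors. *)
Lemma phi_mul a b : 0 <= a -> 0 <= b ->
  phi (a * b) = b * phi a + a * phi b + (a - 1) * (b - 1).
Proof.
rewrite le_eqVlt => /predU1P[<-|a0]; first by rewrite mul0r phi0; lra.
rewrite le_eqVlt => /predU1P[<-|b0]; first by rewrite mulr0 phi0; lra.
by rewrite /phi lnM ?posrE//; ring.
Qed.

Lemma rsum_eq0 (T : choiceType) (a : T -> R) : (forall k, 0 <= a k) -> summ a ->
  rsum a = 0 -> forall k, a k = 0.
Proof.
by move=> a0 sa a1 k; apply/eqP; rewrite eq_le a0 -[leRHS]a1 le1_rsum.
Qed.

Section Superadditivity.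
Variables (T : choiceType) (m : T -> R) (G : T * T -> R).
Hypotheses (m_gt0 : forall k, 0 < m k) (sm : summ m) (m1 : rsum m = 1).
Hypotheses (G_ge0 : forall x, 0 <= G x) (sG : summ G) (G1 : rsum G = 1).
Hypothesis G_sym : forall k l, G (k, l) = G (l, k).

Let M x := m x.1 * m x.2.
Hypothesis sH : summ (fun x => M x * phi (G x / M x)).

(* Young's inequality against the product of two copies of the density
   [e / z], where [e = g / m] on [s] and [e = 1] elsewhere. *)
Lemma superadditivity (s : seq T) : uniq s ->
  2 * \sum_(k <- s) m k * phi (rsum (fun l => G (k, l)) / m k) <=
  rsum (fun x => M x * phi (G x / M x)).
Proof.
move=> us; set g := fun k => rsum (fun l => G (k, l)).
have M_gt0 x : 0 < M x by rewrite mulr_gt0.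
have sM : summ M by apply: summ_pairM.
have M1 : rsum M = 1 by rewrite rsum_pairM// m1 mulr1.
have [sg gE] := rsum_pair_ge0 G_ge0 sG.
rewrite -/g in sg gE; rewrite G1 in gE.
have g0 k : 0 <= g k by apply: rsum_ge0 => //; exact: summ_section.
(* Truncating to the finite list [s] keeps [ln (e k)] bounded, so that its sums against [G] converge
   before the entropy of [g] is known to be finite. *)
pose e k := if k \in s then g k / m k else 1.
have e0 k : 0 <= e k by rewrite /e; case: ifP => // _; rewrite divr_ge0// ltW.
have mE k : m k * (g k / m k) = g k by rewrite mulrCA divff ?mulr1// gt_eqF.
have se : summ (fun k => m k * e k).
  apply: le_summ (summD sm sg) => k; rewrite ger0_norm ?mulr_ge0//; last exact: ltW.
  rewrite /e; case: ifP => _; first by rewrite mE lerDr ltW.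
  by rewrite mulr1 lerDl.
set z := rsum (fun k => m k * e k).
have z_gt0 : 0 < z.
  have [[k ek]|ne] := pselect (exists k, 0 < e k).
    apply: lt_le_trans (le1_rsum k _ se); first by rewrite mulr_gt0.
    by move=> j; rewrite mulr_ge0// ltW.
  have : rsum g = 0.
    rewrite -[RHS](@rsum0 _ T); apply: eq_rsum => k.
    have ek : e k = 0.
      apply/eqP; rewrite eq_le e0 andbT leNgt.
      by apply/negP => ek; apply: ne; exists k.
    move: ek; rewrite /e; case: ifP => _; last by move/eqP; rewrite oner_eq0.
    by move=> gk; rewrite -(mE k) gk mulr0.
  by rewrite gE => /eqP; rewrite oner_eq0.
(* A vanishing marginal forces [G] to vanish on the whole row or column; this is the side condition
   of [phi_young]. *)
have G0 x : e x.1 = 0 \/ e x.2 = 0 -> G x = 0.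
  have Gk k l : e k = 0 -> G (k, l) = 0.
    rewrite /e; case: ifP => _ => [gk|/eqP]; last by rewrite oner_eq0.
    apply: (@rsum_eq0 _ (fun l => G (k, l))) => //; first exact: summ_section.
    by rewrite -/(g k) -(mE k) gk mulr0.
  by case: x => k l /= [|] ?; [|rewrite G_sym]; exact: Gk.
pose le k := ln (e k).
have [B B0 leB] : exists2 B, 0 <= B & forall k, `|le k| <= B.
  exists (\sum_(k <- s) `|le k|) => [|k]; first exact: sumr_ge0.
  have [ks|/negPf ks] := boolP (k \in s).
    by rewrite (big_rem k)//= lerDl sumr_ge0.
  by rewrite /le /e ks ln1 normr0 sumr_ge0.
have s1 : summ (fun x => le x.1 * G x).
  apply: le_summ (summZ B sG) => x.
  by rewrite normrM (ger0_norm (G_ge0 x)) ler_wpM2r.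
have s2 : summ (fun x => le x.2 * G x).
  apply: le_summ (summZ B sG) => x.
  by rewrite normrM (ger0_norm (G_ge0 x)) ler_wpM2r.
have sle : summ (fun k => le k * g k).
  apply: le_summ (summZ B sg) => x.
  by rewrite normrM (ger0_norm (g0 x)) ler_wpM2r.
have r1 : rsum (fun x => le x.1 * G x) = rsum (fun k => le k * g k).
  rewrite -rsum_pair//; apply: eq_rsum => k.
  by rewrite /= rsumZ//; exact: summ_section.
have bsw : bijective (fun x : T * T => (x.2, x.1)).
  by exists (fun x => (x.2, x.1)) => -[].
have r2 : rsum (fun x => le x.2 * G x) = rsum (fun k => le k * g k).
  rewrite -r1 -[RHS](reindex_rsum _ bsw); apply: eq_rsum => -[k l] /=.
  by rewrite G_sym.
pose w x := M x * (e x.1 / z * (e x.2 / z)).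
have sez : summ (fun k => z^-1 * (m k * e k)) by exact: summZ.
have wE x : w x = (z^-1 * (m x.1 * e x.1)) * (z^-1 * (m x.2 * e x.2)).
  by rewrite /w /M; ring.
have sw : summ w.
  by apply: eq_summ (fun x => esym (wE x)) _; exact: (summ_pairM sez sez).
have w1 : rsum w = 1.
  rewrite (eq_rsum wE) (rsum_pairM sez sez) rsumZ// -/z mulVf ?mulr1//.
  by rewrite gt_eqF.
have pt x : le x.1 * G x + le x.2 * G x - 2 * ln z * G x <=
    M x * phi (G x / M x) + w x - M x.
  have v0 : 0 <= G x / M x by rewrite divr_ge0// ltW.
  have ez k : 0 <= e k / z by rewrite divr_ge0// ltW.
  have ez0 k : e k / z = 0 -> e k = 0.
    by move/eqP; rewrite mulf_eq0 invr_eq0 (gt_eqF z_gt0) orbF => /eqP.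
  have : e x.1 / z * (e x.2 / z) = 0 -> G x / M x = 0.
    move/eqP; rewrite mulf_eq0 => /orP[] /eqP/ez0 exz.
      by rewrite G0 ?mul0r//; left.
    by rewrite G0 ?mul0r//; right.
  move=> /(phi_young v0 (mulr_ge0 (ez x.1) (ez x.2))) H.
  have {}H := ler_wpM2l (ltW (M_gt0 x)) H.
  have rhsE a b : M x * (a + b - 1) = M x * a + M x * b - M x by ring.
  rewrite rhsE -/(w x) in H.
  have GE : M x * (G x / M x) = G x by rewrite mulrCA divff ?mulr1// gt_eqF.
  have [[H1 H2]|] : (0 < e x.1 /\ 0 < e x.2) \/ G x = 0.
    have [e1|e1] := ltP 0 (e x.1); last first.
      by right; apply: G0; left; apply/eqP; rewrite eq_le e1 e0.
    have [e2|e2] := ltP 0 (e x.2); last first.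
      by right; apply: G0; right; apply/eqP; rewrite eq_le e2 e0.
    by left.
    move: H; rewrite mulrA GE lnM ?posrE ?divr_gt0// !ln_div ?posrE//.
    by rewrite /le; lra.
  by move=> Gx; move: H; rewrite Gx !(mul0r, mulr0); lra.
have sG2 := summZ (2 * ln z) sG.
have /le_rsum := pt; rewrite rsumB//; last exact: summD.
rewrite rsumD// r1 r2 rsumZ// G1 mulr1.
rewrite rsumB//; last exact: summD.
rewrite rsumD// w1 M1 => H.
have {}H : 2 * rsum (fun k => le k * g k) - 2 * ln z <=
    rsum (fun x => M x * phi (G x / M x)).
  rewrite -[leRHS](addrK 1); apply: le_trans (H _ _); first lra.
    by apply: summB => //; exact: summD.
  by apply: summB => //; exact: summD.
(* Replacing [ln z] by [z - 1] turns the left side into the sum of [le k * g k - m k * e k + m k],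
   which is [m k * phi (g k / m k)] on [s] and 0 elsewhere. *)
apply: le_trans H; have lz := ln_leB1 z_gt0.
rewrite -mulrBr ler_pM2l//.
apply: (@le_trans _ _ (rsum (fun k => le k * g k - m k * e k + m k))); last first.
  rewrite rsumD//; last exact: summB.
  by rewrite rsumB// m1 -/z; lra.
have tE k : le k * g k - m k * e k + m k =
    if k \in s then m k * phi (g k / m k) else 0.
  rewrite /le /e; case: ifP => _; last by rewrite ln1; lra.
  by rewrite /phi; move: (mE k); move: (g k / m k) => r <-; ring.
have -> : \sum_(k <- s) m k * phi (g k / m k) =
    \sum_(k <- s) (le k * g k - m k * e k + m k).
  by rewrite big_seq [RHS]big_seq; apply: eq_bigr => k ks; rewrite tE ks.
apply: (sum_le_rsum (a := fun k => le k * g k - m k * e k + m k)) => // [k|].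
  by rewrite tE; case: ifP => // _; rewrite mulr_ge0 ?phi_ge0 ?divr_ge0// ltW.
by apply: summD => //; exact: summB.
Qed.
End Superadditivity.

End Entropy.

(** * Entropy decay along one Euler step *)

Section OneStep.
Context {R : realType}.
Variables (K : int -> int -> R) (C : R).
Hypotheses (K_gt0 : forall k l, 0 < K k l) (K_le : forall k l, K k l <= C).
Variable m : int -> R.
Hypotheses (m_gt0 : forall k, 0 < m k) (sm : summ m) (m1 : rsum m = 1).
Hypothesis m_db : detailed_balance K m.

Definition euler_step (h : R) (f : int -> R) (k : int) : R := f k + h * collision K f k.

Definition swap_pair (x : int * int) : int * int := (x.2, x.1).
(* The collision [(l, k) -> (l - 1, k + 1)] followed by a swap, which makes it
   an involution. *)
Definition collide (x : int * int) : int * int := (x.2 + 1, x.1 - 1).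

Definition prod_density (f : int -> R) (x : int * int) : R :=
  (f x.1 / m x.1) * (f x.2 / m x.2).
Definition coll_weight (x : int * int) : R := K x.1 x.2 * (m x.1 * m x.2).

(* The density, with respect to [m (x) m], of the symmetrized law of two
   particles of law [f] after one collision step. *)
Definition post_density (h : R) (f : int -> R) (x : int * int) : R :=
  (1 - h * K x.1 x.2 - h * K x.2 x.1) * prod_density f x
  + h * K x.1 x.2 * prod_density f (collide x)
  + h * K x.2 x.1 * prod_density f (collide (swap_pair x)).

Lemma swap_pairK : involutive swap_pair. Proof. by case. Qed.

Lemma collideK : involutive collide.
Proof. by case=> k l; rewrite /collide /= subrK addrK. Qed.

Lemma bij_swap : bijective swap_pair. Proof. exact: inv_bij swap_pairK. Qed.
Lemma bij_collide : bijective collide. Proof. exact: inv_bij collideK. Qed.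

(** Detailed balance, read as reversibility of the collision for [m (x) m]; it lets the kernel act
    on densities instead of laws. *)
Lemma coll_weight_collide x : coll_weight (collide x) = coll_weight x.
Proof.
case: x => k l; rewrite /coll_weight /collide /= !mulrA.
by have := m_db k (l + 1); rewrite addrK => ->.
Qed.

Lemma coll_weight_gt0 x : 0 < coll_weight x.
Proof. by rewrite !mulr_gt0. Qed.

Lemma prod_density_swap f x : prod_density f (swap_pair x) = prod_density f x.
Proof. by rewrite /prod_density mulrC. Qed.

Lemma post_density_swap h f x : post_density h f (swap_pair x) = post_density h f x.
Proof.
by rewrite /post_density swap_pairK prod_density_swap /=; ring.
Qed.

Lemma prod_densityE f x : m x.1 * m x.2 * prod_density f x = f x.1 * f x.2.
Proof. by rewrite /prod_density; field; rewrite !gt_eqF. Qed.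

Lemma coll_weight_density f x :
  coll_weight x * prod_density f x = K x.1 x.2 * (f x.1 * f x.2).
Proof. by rewrite -prod_densityE /coll_weight; ring. Qed.

Variables (f : int -> R) (h : R).
Hypotheses (f_ge0 : forall k, 0 <= f k) (sf : summ f) (f1 : rsum f = 1).
Hypotheses (h_gt0 : 0 < h) (hC : 2 * h * C < 1).

Let K_norm k l : `|K k l| <= C. Proof. by rewrite gtr0_norm. Qed.
Let r k := f k / m k.
Let r_ge0 k : 0 <= r k. Proof. by rewrite divr_ge0// ltW. Qed.
Let mr k : m k * r k = f k. Proof. by rewrite mulrCA divff ?mulr1// gt_eqF. Qed.
Let u := prod_density f.
Let u_ge0 x : 0 <= u x. Proof. exact: mulr_ge0 (r_ge0 _) (r_ge0 _). Qed.
Let v := post_density h f.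
Let M x := m x.1 * m x.2.
Let M_gt0 x : 0 < M x. Proof. by rewrite mulr_gt0. Qed.

(** The origin of the step restriction [2 * h * C < 1]: with positive probability neither ordering
    of the pair collides. *)
Let p_gt0 x : 0 < 1 - h * K x.1 x.2 - h * K x.2 x.1.
Proof.
have le k l : h * K k l <= h * C by rewrite ler_wpM2l// ltW.
by have := le x.1 x.2; have := le x.2 x.1; have := hC; lra.
Qed.

Lemma post_density_ge0 x : 0 <= post_density h f x.
Proof.
rewrite /post_density -/u addr_ge0 ?addr_ge0//.
- by rewrite mulr_ge0 ?(ltW (p_gt0 _)).
- by rewrite mulr_ge0// mulr_ge0// ltW.
- by rewrite mulr_ge0// mulr_ge0// ltW.
Qed.

Lemma euler_stepE k : euler_step h f k = f k + h *
  (flux K f (k - 1) - flux (fun l k => K k l) f k - flux K f k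
   + flux (fun l k => K k l) f (k + 1)).
Proof. by rewrite /euler_step (collisionE K_norm). Qed.

(** The losses at [k] are [f k] times a total rate of at most [2 * C], since [f] has mass 1; the
    step restriction keeps the remaining factor nonnegative. *)
Lemma euler_step_ge0 k : 0 <= euler_step h f k.
Proof.
rewrite euler_stepE.
have K'_norm l j : `|(fun l k => K k l) l j| <= C by [].
have rate_ge0 J l : (forall i j, 0 < J i j) -> (forall i j, `|J i j| <= C) -> 0 <= rate J f l.
  move=> J0 JC; apply: rsum_ge0 (summ_rate JC l sf) => j.
  by rewrite mulr_ge0// ltW.
have A := rate_le K_norm k sf; have B := rate_le K'_norm k sf.
rewrite (ge0_norm1 f_ge0) f1 mulr1 ger0_norm ?rate_ge0// in A.
rewrite (ge0_norm1 f_ge0) f1 mulr1 ger0_norm ?rate_ge0// in B.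
have P1 : 0 <= h * flux K f (k - 1) by rewrite !mulr_ge0 ?rate_ge0// ltW.
have P2 : 0 <= h * flux (fun l k => K k l) f (k + 1) by rewrite !mulr_ge0 ?rate_ge0// ltW.
have P3 : 0 <= (1 - h * rate K f k - h * rate (fun l k => K k l) f k) * f k.
  rewrite mulr_ge0//; have := ler_wpM2l (ltW h_gt0) A.
  by have := ler_wpM2l (ltW h_gt0) B; have := hC; lra.
by move: P1 P2 P3; rewrite /flux; lra.
Qed.

Lemma summ_euler_step : summ (euler_step h f).
Proof. by apply: summD => //; apply/summZ/(summ_collision K_norm). Qed.

Lemma rsum_euler_step : rsum (euler_step h f) = 1.
Proof.
have sQ := summ_collision K_norm sf.
by rewrite rsumD ?rsumZ// ?(rsum_collision K_norm)// ?mulr0 ?addr0//; exact: summZ.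
Qed.

Let F x := f x.1 * f x.2.
Let sF : summ F. Proof. exact: summ_pairM. Qed.
Let G x := M x * v x.
Let KF x := K x.1 x.2 * F x.

Let sKF : summ KF.
Proof.
apply: le_summ (summZ C sF) => x; have F0 : 0 <= F x by rewrite mulr_ge0.
by rewrite ger0_norm ?mulr_ge0 ?ler_wpM2r// ltW.
Qed.

Let sKFc : summ (KF \o collide). Proof. exact/(reindex_summ _ bij_collide). Qed.

Let GE x : G x = F x - h * KF x - h * KF (swap_pair x) + h * KF (collide x)
  + h * KF (collide (swap_pair x)).
Proof.
rewrite /KF /F -!coll_weight_density !coll_weight_collide /G /v /post_density.
rewrite -(prod_densityE f x) prod_density_swap /coll_weight /M /=.
by ring.
Qed.

Let sG : summ G.
Proof.
apply: (eq_summ (fun x => esym (GE x))).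
apply: summD; last first.
  by apply: summZ; apply/(reindex_summ (KF \o collide) bij_swap).
apply: summD; last exact: summZ.
apply: summB; last by apply: summZ; apply/(reindex_summ KF bij_swap).
by apply: summB => //; exact: summZ.
Qed.

Let G_sym k l : G (k, l) = G (l, k).
Proof. by rewrite /G /v -post_density_swap /M /= mulrC (mulrC (m k)) mulrC. Qed.

(** Summing out the second particle, [f l * f k] gives [f l] by unit mass, and the four collision
    terms give the four fluxes of [Q]. *)
Let G_marginal l : rsum (fun k => G (l, k)) = euler_step h f l.
Proof.
rewrite euler_stepE (eq_rsum (fun k => GE (l, k))).
have K'_norm i j : `|(fun l k => K k l) i j| <= C by [].
have t0 : summ (fun k => f l * f k) by exact: summZ.
have u1 : summ (fun k => K l k * f k) := summ_rate K'_norm l sf.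
have u2 := summ_rate K_norm l sf.
have u3 := summ_shift 1 (summ_rate K_norm (l - 1) sf).
have u4 : summ (fun k => K (l + 1) (k - 1) * f (k - 1)) :=
  summ_shift (-1) (summ_rate K'_norm (l + 1) sf).
have t1 := summZ (h * f l) u1; have t2 := summZ (h * f l) u2.
have t3 := summZ (h * f (l - 1)) u3; have t4 := summZ (h * f (l + 1)) u4.
transitivity (rsum (fun k => f l * f k
   - (h * f l) * (K l k * f k) - (h * f l) * (K k l * f k)
   + (h * f (l - 1)) * (K (k + 1) (l - 1) * f (k + 1))
   + (h * f (l + 1)) * (K (l + 1) (k - 1) * f (k - 1)))).
  by apply: eq_rsum => k; rewrite /F /KF /F /=; ring.
have t01 := summB t0 t1; have t012 := summB t01 t2; have t0123 := summD t012 t3.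
rewrite (rsumD t0123 t4) (rsumD t012 t3) (rsumB t01 t2) (rsumB t0 t1).
rewrite (rsumZ _ sf) (rsumZ _ u1) (rsumZ _ u2) (rsumZ _ u3) (rsumZ _ u4).
rewrite (rsum_shift 1 (fun k => K k (l - 1) * f k)).
rewrite (rsum_shift (-1) (fun k => K (l + 1) k * f k)).
by rewrite f1 /flux /rate; ring.
Qed.

Hypothesis sH : summ (fun k => m k * phi (r k)).

Let H := rsum (fun k => m k * phi (r k)).

Let MphiE x : M x * phi (u x) =
  (m x.1 * phi (r x.1)) * f x.2 + f x.1 * (m x.2 * phi (r x.2))
  + (f x.1 - m x.1) * (f x.2 - m x.2).
Proof.
have E : phi (u x) = _ := phi_mul (r_ge0 x.1) (r_ge0 x.2).
by rewrite E /M -(mr x.1) -(mr x.2); ring.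
Qed.

Let sfm : summ (fun k => f k - m k). Proof. exact: summB. Qed.
Let sMphi : summ (fun x => M x * phi (u x)).
Proof.
apply: (eq_summ (fun x => esym (MphiE x))).
apply: summD; last exact: (summ_pairM sfm sfm).
by apply: summD; [exact: (summ_pairM sH sf)|exact: (summ_pairM sf sH)].
Qed.

Let rsum_Mphi : rsum (fun x => M x * phi (u x)) = 2 * H.
Proof.
have p1 := summ_pairM sH sf; have p2 := summ_pairM sf sH.
have p3 := summ_pairM sfm sfm.
rewrite (eq_rsum MphiE) (rsumD (summD p1 p2) p3) (rsumD p1 p2).
rewrite (rsum_pairM sH sf) (rsum_pairM sf sH) (rsum_pairM sfm sfm).
by rewrite rsumB// f1 m1 -/H; ring.
Qed.

(** Jensen's inequality, summed over all pairs, is compared with superadditivity, and the result is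
    halved. The list [s] is finite because the entropy of the new iterate is not yet known to be
    finite. *)
Lemma entropy_step (s : seq int) (t : seq (int * int)) : uniq s -> uniq t ->
  \sum_(k <- s) m k * phi (euler_step h f k / m k)
  + h * \sum_(x <- t) coll_weight x *
     breg (prod_density f (collide x)) (post_density h f x)
  <= rsum (fun k => m k * phi (f k / m k)).
Proof.
move=> us ut.
pose X x := coll_weight x * phi (u x).
have sX : summ X.
  apply: le_summ (summZ C sMphi) => x; rewrite /X /coll_weight -mulrA.
  have Mp : 0 <= M x * phi (u x) := mulr_ge0 (ltW (M_gt0 x)) (phi_ge0 (u_ge0 x)).
  by rewrite normrM (ger0_norm Mp) ler_wpM2r.
have sXc : summ (X \o collide) by apply/(reindex_summ X bij_collide).
have rXc : rsum (X \o collide) = rsum X by exact: (reindex_rsum X bij_collide).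
pose Z x := coll_weight x * breg (u (collide x)) (v x).
have Z0 x : 0 <= Z x by exact: mulr_ge0 (ltW (coll_weight_gt0 _)) (breg_ge0 _ _).
have v0 x : 0 <= v x by exact: post_density_ge0.
pose D x := M x * phi (u x) - h * X x - h * X (swap_pair x)
   + h * X (collide x) + h * X (collide (swap_pair x)).
have jensen x : M x * phi (v x) + h * Z x + h * Z (swap_pair x) <= D x.
  have hK k l : 0 < h * K k l by rewrite mulr_gt0.
  have := @phi_jensen R (1 - h * K x.1 x.2 - h * K x.2 x.1) (h * K x.1 x.2)
    (h * K x.2 x.1) (u x) (u (collide x)) (u (collide (swap_pair x))) (v x)
    (p_gt0 x) (hK _ _) (hK _ _).
  have pE a b : 1 - a - b + a + b = 1 :> R by ring.
  move=> /(_ (pE _ _) (u_ge0 _) (u_ge0 _) (u_ge0 _) erefl) J.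
  have {J} := ler_wpM2l (ltW (M_gt0 x)) J.
  have vs : v (swap_pair x) = v x by exact: post_density_swap.
  have us' : u (swap_pair x) = u x by exact: prod_density_swap.
  by rewrite /D /X /Z !coll_weight_collide vs us' /coll_weight /M /=; lra.
have sXs : summ (X \o swap_pair) by apply/(reindex_summ X bij_swap).
have rXs : rsum (X \o swap_pair) = rsum X by exact: (reindex_rsum X bij_swap).
have sXcs : summ ((X \o collide) \o swap_pair) by apply/(reindex_summ _ bij_swap).
have rXcs : rsum ((X \o collide) \o swap_pair) = rsum X.
  by rewrite (reindex_rsum (X \o collide) bij_swap).
have d1 := summB sMphi (summZ h sX); have d2 := summB d1 (summZ h sXs).
have d3 := summD d2 (summZ h sXc); have sD : summ D := summD d3 (summZ h sXcs).
(* [swap_pair] and [collide] are bijections, so the four copies of [X] have equal sums and cancel;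
   only the entropy of the product law remains. *)
have rD : rsum D = 2 * H.
  rewrite /D (rsumD d3 (summZ h sXcs)) (rsumD d2 (summZ h sXc)).
  rewrite (rsumB d1 (summZ h sXs)) (rsumB sMphi (summZ h sX)) !rsumZ//.
  by rewrite rXs rXc rXcs rsum_Mphi; ring.
have hZ0 x : 0 <= h * Z x by rewrite mulr_ge0// ltW.
have Mp0 x : 0 <= M x * phi (v x) by rewrite mulr_ge0 ?phi_ge0// ltW.
have sMv : summ (fun x => M x * phi (v x)).
  apply: le_summ sD => x; rewrite ger0_norm//.
  by have := jensen x; have := hZ0 x; have := hZ0 (swap_pair x); lra.
have shZ : summ (fun x => h * Z x).
  apply: le_summ sD => x; rewrite ger0_norm//.
  by have := jensen x; have := Mp0 x; have := hZ0 (swap_pair x); lra.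
have shZs : summ ((fun x => h * Z x) \o swap_pair) by apply/(reindex_summ _ bij_swap).
have rhZs : rsum ((fun x => h * Z x) \o swap_pair) = rsum (fun x => h * Z x).
  exact: (reindex_rsum (fun x => h * Z x) bij_swap).
have := le_rsum jensen (summD (summD sMv shZ) shZs) sD.
rewrite rD (rsumD (summD sMv shZ) shZs) (rsumD sMv shZ) rhZs => main.
have vE x : G x / M x = v x by rewrite /G mulrC mulKf// gt_eqF.
have sMG : summ (fun x => M x * phi (G x / M x)).
  by apply: eq_summ sMv => x; rewrite vE.
have G0 x : 0 <= G x by rewrite mulr_ge0// ltW.
have G1 : rsum G = 1.
  by rewrite -rsum_pair// (eq_rsum G_marginal) rsum_euler_step.
have := superadditivity m_gt0 sm m1 G0 sG G1 G_sym sMG us.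
under eq_bigr do rewrite G_marginal.
rewrite (eq_rsum (b := fun x => M x * phi (v x))); last by move=> x; rewrite vE.
have := sum_le_rsum hZ0 shZ ut; rewrite -mulr_sumr.
by rewrite -/H; lra.
Qed.

End OneStep.

(** * Convergence of the Euler scheme *)

Section Solution.
Context {R : realType}.

(** The derivative is bounded only on the open interval, since the equation is given for positive
    times only; at [a], possibly 0, continuity suffices. *)
Lemma mean_value_real (F D : R -> R) (a b omega : R) : 0 <= a -> a < b ->
  (forall t : R, 0 <= t -> forall e : R, 0 < e -> exists2 d : R, 0 < d & forall s : R, 0 <= s ->
     `|s - t| < d -> `|F s - F t - (s - t) * D t| <= e * `|s - t|) ->
  (forall c : R, a < c -> c < b -> D c <= omega) ->
  F b - F a <= omega * (b - a).
Proof.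
move=> a0 ab FD Dle.
have cF : {within `[a, b], continuous F}.
  apply/subspace_continuousP => x /=; rewrite in_itv/= => /andP[ax _].
  have x0 : 0 <= x by exact: le_trans ax.
  have [d d0 H] := FD x x0 1 ltr01.
  apply/cvgrPdist_le => e e0.
  have D1 : 0 < 1 + `|D x| by rewrite ltr_wpDr.
  have m0 : 0 < Num.min d (e / (1 + `|D x|)) by rewrite lt_min d0 divr_gt0.
  rewrite near_withinE; apply/nbhs_ballP; exists (Num.min d (e / (1 + `|D x|))) => //= y.
  rewrite /ball/= distrC lt_min => /andP[yd ye]; rewrite in_itv/= => /andP[ay _].
  have y0 := le_trans a0 ay.
  have := H y y0 yd; rewrite mul1r => Hy.
  rewrite distrC (_ : F y - F x = (F y - F x - (y - x) * D x) + (y - x) * D x); last by ring.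
  rewrite (le_trans (ler_normD _ _))// normrM.
  move: ye; rewrite ltr_pdivlMr// => ye; nra.
have dF x : x \in `]a, b[%R -> is_derive x 1 F (D x).
  rewrite in_itv/= => /andP[ax xb]; have x0 : 0 < x by exact: le_lt_trans ax.
  suff cv : h^-1 *: (F (h *: 1 + x) - F x) @[h --> 0^'] --> D x.
    by apply: DeriveDef; [exact: cvgP cv|exact: cvg_lim cv].
  apply/cvgrPdist_le => e e0; have [d d0 H] := FD x (ltW x0) e e0.
  have m0 : 0 < Num.min d x by rewrite lt_min d0.
  rewrite near_withinE; apply/nbhs_ballP; exists (Num.min d x) => //= h.
  rewrite /ball/= sub0r normrN lt_min => /andP[hd hx] hn0.
  have hE : h *: 1 + x - x = h by rewrite addrK [_ *: _]mulr1.
  have := H (h *: 1 + x); rewrite hE => /(_ _ hd) H1.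
  have {}H1 : `|F (h *: 1 + x) - F x - h * D x| <= e * `|h|.
    apply: H1; move: hx; rewrite ltr_norml => /andP[hx _].
    by rewrite [_ *: _]mulr1; lra.
  have hh : 0 < `|h| by rewrite normr_gt0.
  rewrite distrC -(ler_pM2r hh) -normrM mulrBl [_ *: _]mulrC mulrVK ?unitfE//.
  by rewrite (mulrC (D x)).
have [c /[!in_itv]/= /andP[ac cb] ->] := MVT ab dF cF.
by apply: ler_wpM2r; [rewrite subr_ge0 ltW|exact: Dle].
Qed.

(** Duality with finitely supported sign vectors, [e] being the sign of [x]; it reduces the mean
    value inequality in ell_1 to real functions. *)
Lemma norm1_ub (T : choiceType) (x : T -> R) (M : R) : summ x ->
  (forall (s : seq T) (e : T -> R), uniq s -> (forall k, `|e k| <= 1) ->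
     \sum_(k <- s) e k * x k <= M) -> norm1 x <= M.
Proof.
move=> sx H; apply: rsum_le => [//||s us]; first exact: summ_norm.
rewrite (eq_bigr (fun k => Num.sg (x k) * x k)); last first.
  by move=> k _; rewrite normrEsg.
by apply: H => // k; rewrite normr_sg; case: (x k != 0).
Qed.

Lemma sum_le_norm1 (T : choiceType) (x : T -> R) (s : seq T) (e : T -> R) : summ x ->
  uniq s -> (forall k, `|e k| <= 1) -> `|\sum_(k <- s) e k * x k| <= norm1 x.
Proof.
move=> sx us e1; apply: le_trans (ler_norm_sum _ _ _) _.
apply: le_trans (sum_le_rsum (a := fun k => `|x k|) _ (summ_norm sx) us) => //.
by apply: ler_sum => k _; rewrite normrM ler_piMl.
Qed.

Section MeanValue.
Variables (T : choiceType) (f df : R -> T -> R).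
Hypotheses (sf : forall t : R, 0 <= t -> summ (f t)).
Hypotheses (sdf : forall t : R, 0 <= t -> summ (df t)).
Hypothesis f_diff : forall t : R, 0 <= t -> forall e : R, 0 < e -> exists2 d : R, 0 < d &
  forall s : R, 0 <= s -> `|s - t| < d ->
    norm1 (fun k => f s k - f t k - (s - t) * df t k) <= e * `|s - t|.

Lemma norm1_mean_value (c : T -> R) (a b omega : R) : 0 <= a -> a < b -> summ c ->
  (forall t : R, a < t -> t < b -> norm1 (fun k => df t k - c k) <= omega) ->
  norm1 (fun k => f b k - f a k - (b - a) * c k) <= omega * (b - a).
Proof.
move=> a0 ab sc H; have b0 : 0 <= b by rewrite (le_trans a0)// ltW.
have sfb := sf b0; have sfa := sf a0.
have sfc : summ (fun k => f b k - f a k - (b - a) * c k).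
  by apply: summB; [exact: summB|exact: summZ].
apply: norm1_ub => // s e us e1.
pose F t := \sum_(k <- s) e k * (f t k - t * c k).
pose D t := \sum_(k <- s) e k * (df t k - c k).
have -> : \sum_(k <- s) e k * (f b k - f a k - (b - a) * c k) = F b - F a.
  by rewrite /F -sumrB; apply: eq_bigr => k _; ring.
apply: (@mean_value_real F D) => // [t t0 d d0|t ta tb].
  have [d' d'0 Hd] := f_diff t0 d0; exists d' => // u u0 ut.
  apply: le_trans (Hd u u0 ut).
  have -> : F u - F t - (u - t) * D t =
      \sum_(k <- s) e k * (f u k - f t k - (u - t) * df t k).
    by rewrite /F /D mulr_sumr -!sumrB; apply: eq_bigr => k _; ring.
  have sft := sf t0; have sfu := sf u0; have sdft := sdf t0.
  by apply: sum_le_norm1 => //; apply: summB; [exact: summB|exact: summZ].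
have t0 : 0 <= t by rewrite (le_trans a0)// ltW.
apply: le_trans (H t ta tb); apply: le_trans (ler_norm _) _.
by apply: sum_le_norm1 => //; apply: summB => //; exact: sdf.
Qed.

Lemma norm1_continuous (t : R) : 0 <= t -> exists2 d : R, 0 < d & forall s : R, 0 <= s ->
  `|s - t| < d -> norm1 (fun k => f s k - f t k) <= (1 + norm1 (df t)) * `|s - t|.
Proof.
move=> t0; have [d d0 H] := f_diff t0 ltr01; exists d => // s s0 /(H s s0) {}H.
have sft := sf t0; have sfs := sf s0; have sdft := sdf t0.
have sZ := summZ (s - t) sdft.
rewrite (_ : (fun k => f s k - f t k) =
  fun k => (f s k - f t k - (s - t) * df t k) + (s - t) * df t k).
  apply: le_trans (norm1D _ sZ) _; first by apply: summB => //; exact: summB.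
  by rewrite norm1Z//; rewrite mul1r in H; nra.
by apply/funext => k; ring.
Qed.

(** Nonnegativity and conservation of mass are themselves deduced from the scheme, so the a priori
    bound comes from continuity on a compact interval. *)
Lemma norm1_bounded (b : R) : 0 <= b ->
  exists2 M : R, 0 <= M & forall t : R, 0 <= t -> t <= b -> norm1 (f t) <= M.
Proof.
move=> b0.
have [|c /[!in_itv]/= /andP[c0 cb] H] := @EVT_max R (fun t => norm1 (f t)) 0 b b0.
  apply/subspace_continuousP => x /=; rewrite in_itv/= => /andP[x0 _].
  have [d d0 H] := norm1_continuous x0; have sfx := sf x0.
  have n0 := norm1_ge0 (sdf x0).
  apply/cvgrPdist_le => e e0.
  have D1 : 0 < 1 + norm1 (df x) by rewrite ltr_wpDr.
  have m0 : 0 < Num.min d (e / (1 + norm1 (df x))) by rewrite lt_min d0 divr_gt0.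
  rewrite near_withinE; apply/nbhs_ballP; exists (Num.min d (e / (1 + norm1 (df x)))) => //= y.
  rewrite /ball/= distrC lt_min => /andP[yd ye]; rewrite in_itv/= => /andP[y0 _].
  have sfy := sf y0; have sfyx := summB sfy sfx; have Hy := H y y0 yd.
  have tri1 : norm1 (f y) <= norm1 (fun k => f y k - f x k) + norm1 (f x).
    apply: le_trans (norm1D sfyx sfx); rewrite le_eqVlt; apply/orP; left; apply/eqP.
    by congr norm1; apply/funext => k; rewrite subrK.
  have tri2 : norm1 (f x) <= norm1 (f y) + norm1 (fun k => f y k - f x k).
    apply: le_trans (norm1B sfy sfyx); rewrite le_eqVlt; apply/orP; left; apply/eqP.
    by congr norm1; apply/funext => k; rewrite subKr.
  move: ye; rewrite ltr_pdivlMr// => ye.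
  rewrite -[X in `|X|]/(norm1 (f x) - norm1 (f y)).
  by rewrite ler_norml; apply/andP; split; lra.
exists (norm1 (f c)) => [|t t0 tb]; first exact: norm1_ge0 (sf c0).
by apply: H; rewrite in_itv/= t0.
Qed.
End MeanValue.

Section Euler.
Variables (K : int -> int -> R) (C : R).
Hypotheses (K_gt0 : forall k l, 0 < K k l) (K_le : forall k l, K k l <= C).
Variables (f : R -> int -> R) (df : R -> int -> R).
Hypotheses (sf : forall t : R, 0 <= t -> summ (f t)).
Hypotheses (sdf : forall t : R, 0 <= t -> summ (df t)).
Hypothesis f_diff : forall t : R, 0 <= t -> forall e : R, 0 < e -> exists2 d : R, 0 < d &
  forall s : R, 0 <= s -> `|s - t| < d ->
    norm1 (fun k => f s k - f t k - (s - t) * df t k) <= e * `|s - t|.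
Hypothesis f_eq : forall t : R, 0 < t -> df t = collision K (f t).

Definition prob_vec (g : int -> R) : Prop :=
  [/\ forall k, 0 <= g k, summ g & rsum g = 1].

Definition euler (h : R) (g : int -> R) (i : nat) : int -> R :=
  iter i (euler_step K h) g.

Let K_norm k l : `|K k l| <= C. Proof. by rewrite gtr0_norm. Qed.
Let C_gt0 : 0 < C. Proof. exact: lt_le_trans (K_gt0 0 0) (K_le 0 0). Qed.

Lemma euler_prob_vec (h : R) g i : 0 < h -> 2 * h * C < 1 ->
  prob_vec g -> prob_vec (euler h g i).
Proof.
move=> h0 hC dg; elim: i => [//|i [p0 sp p1]]; split.
- exact: (euler_step_ge0 K_gt0 K_le).
- exact: (summ_euler_step K_gt0 K_le).
- exact: (rsum_euler_step K_gt0 K_le).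
Qed.

(** The local error is quadratic because [f] is Lipschitz in time and [collision K] is Lipschitz on
    the ball of radius [M]; [B] is the product of the two constants. *)
Lemma consistency (b : R) : 0 <= b -> exists2 B : R, 0 <= B &
  forall s t : R, 0 <= s -> s < t -> t <= b ->
  norm1 (fun k => f t k - f s k - (t - s) * collision K (f s) k) <= B * (t - s) ^+ 2.
Proof.
move=> b0; have [M M0 HM] := norm1_bounded sf sdf f_diff b0.
pose L := 4 * C * M ^+ 2.
have L0 : 0 <= L by rewrite /L !mulr_ge0 ?exprn_ge0// ltW.
have lip s t : 0 <= s -> s < t -> t <= b ->
    norm1 (fun k => f t k - f s k) <= L * (t - s).
  move=> s0 st tb; have t0 : 0 <= t by rewrite (le_trans s0)// ltW.
  have := @norm1_mean_value _ f df sf sdf f_diff (fun=> 0) s t L s0 st (summ0 _).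
  rewrite (_ : (fun k => f t k - f s k - (t - s) * 0) = fun k => f t k - f s k).
    apply=> c sc ct; have c0 : 0 < c by exact: le_lt_trans sc.
    rewrite (_ : (fun k => df c k - 0) = collision K (f c)); last first.
      by apply/funext => k; rewrite subr0 f_eq.
    apply: le_trans (collision_le K_norm (sf (ltW c0))) _.
    rewrite /L ler_pM2l ?mulr_gt0// ler_sqr ?nnegrE//.
      by apply: HM; lra.
    exact: norm1_ge0 (sf (ltW c0)).
  by apply/funext => k; rewrite mulr0 subr0.
exists (4 * C * (M + M) * L); first by rewrite !mulr_ge0// ?addr_ge0// ltW.
move=> s t s0 st tb; rewrite expr2 mulrA.
have sQ := summ_collision K_norm (sf s0).
apply: (@norm1_mean_value _ f df) => // c sc ct.
have c0 : 0 < c by exact: le_lt_trans sc.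
rewrite f_eq//; apply: le_trans (collisionB_le K_norm (sf (ltW c0)) (sf s0)) _.
have cs := @lip s c s0 sc (le_trans (ltW ct) tb).
have Mc := HM c (ltW c0) (le_trans (ltW ct) tb).
have Ms : norm1 (f s) <= M by apply: HM => //; lra.
rewrite -[leRHS]mulrA; apply: ler_pM.
- apply: mulr_ge0; first by rewrite mulr_ge0// ltW.
  by apply: addr_ge0; apply: norm1_ge0; apply: sf => //; exact: ltW.
- by apply: norm1_ge0; apply: summB; apply: sf => //; exact: ltW.
- by rewrite ler_pM2l ?mulr_gt0// lerD.
- by apply: le_trans cs _; rewrite ler_wpM2l// lerD2r ltW.
Qed.

(** Discrete Gronwall: a step multiplies the old error by at most [1 + L * h] and adds at most
    [B * h ^+ 2]. The constant [D] does not depend on [n]. *)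
Lemma euler_error (s t : R) : 0 <= s -> s < t -> prob_vec (f s) ->
  exists2 D : R, 0 <= D & forall n, (0 < n)%N -> let h := (t - s) / n%:R in
  2 * h * C < 1 -> forall i, (i <= n)%N ->
  norm1 (fun k => f (s + i%:R * h) k - euler h (f s) i k) <= D * h.
Proof.
move=> s0 st ds; have t0 : 0 <= t by rewrite (le_trans s0)// ltW.
have [M M0 HM] := norm1_bounded sf sdf f_diff t0.
have [B B0 HB] := consistency t0.
(* The Lipschitz constant of [collision K] between the solution, of norm at most [M], and the
   iterates, of norm 1. *)
pose L := 4 * C * (M + 1).
have L0 : 0 <= L by rewrite /L !mulr_ge0 ?addr_ge0// ltW.
exists (B * (t - s) * expR (L * (t - s))).
  by rewrite !mulr_ge0 ?expR_ge0// subr_ge0 ltW.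
move=> n n0 h hC i ilen.
have nR : 0 < n%:R :> R by rewrite ltr0n.
have h0 : 0 < h by rewrite divr_gt0// subr_gt0.
have nh : n%:R * h = t - s by rewrite /h mulrC divfK// gt_eqF.
have le_t j : (j <= n)%N -> s + j%:R * h <= t.
  move=> jn; have : j%:R * h <= n%:R * h by rewrite ler_pM2r// ler_nat.
  by rewrite nh; lra.
have ge_0 j : 0 <= s + j%:R * h by rewrite addr_ge0// mulr_ge0// ltW.
have step : norm1 (fun k => f (s + i%:R * h) k - euler h (f s) i k) <=
    B * h ^+ 2 * i%:R * (1 + L * h) ^+ i.
  elim: i ilen => [_|i IH ilen].
    rewrite mul0r addr0 mulr0 mul0r le_eqVlt; apply/orP; left; apply/eqP.
    by rewrite /norm1 -[RHS](@rsum0 _ int); apply: eq_rsum => k; rewrite subrr normr0.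
  have {}IH := IH (ltnW ilen).
  set a := s + i%:R * h in IH; set b := s + i.+1%:R * h.
  have ba : b - a = h by rewrite /a /b -natr1; ring.
  have ab : a < b by rewrite -subr_gt0 ba.
  have [g0 sg g1] := @euler_prob_vec h (f s) i h0 hC ds.
  set g := euler h (f s) i in IH g0 sg g1 *.
  have sa := sf (ge_0 i); have sb := sf (ge_0 i.+1).
  have sQa := summ_collision K_norm sa; have sQg := summ_collision K_norm sg.
  have sag := summB sa sg; have sQag := summB sQa sQg.
  have c1 : summ (fun k => f b k - f a k - h * collision K (f a) k).
    by apply: summB; [exact: summB|exact: summZ].
  have c2 := summZ h sQag.
  rewrite (_ : (fun k => f b k - euler h (f s) i.+1 k) = fun k =>
    (f b k - f a k - h * collision K (f a) k) +
    ((f a k - g k) + h * (collision K (f a) k - collision K g k))); last first.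
    by apply/funext => k; rewrite /euler iterS -/(euler h _ _) -/g /euler_step; ring.
  apply: le_trans (norm1D c1 (summD sag c2)) _.
  have t1 := HB a b (ge_0 i) ab (le_t i.+1 ilen); rewrite ba in t1.
  have t2 := norm1D sag c2; rewrite norm1Z// gtr0_norm// in t2.
  have t3 := collisionB_le K_norm sa sg.
  have Ma : norm1 (f a) <= M by exact: HM (ge_0 i) (le_t i (ltnW ilen)).
  have Mg : norm1 g = 1 by rewrite ge0_norm1.
  set e := norm1 (fun k => f a k - g k) in t2 t3 IH.
  have e0 : 0 <= e by exact: norm1_ge0.
  have t4 : norm1 (fun k => collision K (f a) k - collision K g k) <= L * e.
    apply: le_trans t3 _; rewrite Mg ler_wpM2r// /L ler_pM2l ?mulr_gt0// lerD2r//.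
  have t5 := ler_wpM2l (ltW h0) t4.
  have q0 : 1 <= 1 + L * h by rewrite lerDl mulr_ge0// ltW.
  have t6 : (1 + L * h) * e <= (1 + L * h) * (B * h ^+ 2 * i%:R * (1 + L * h) ^+ i).
    by rewrite ler_wpM2l// (le_trans ler01).
  have t7 : B * h ^+ 2 <= B * h ^+ 2 * (1 + L * h) ^+ i.+1.
    by rewrite ler_peMr ?exprn_ege1// mulr_ge0// exprn_ge0// ltW.
  apply: (@le_trans _ _ (B * h ^+ 2 * (1 + L * h) ^+ i.+1 +
     (1 + L * h) * (B * h ^+ 2 * i%:R * (1 + L * h) ^+ i))); last first.
    rewrite -natr1 (exprS (1 + L * h)) le_eqVlt; apply/orP; left; apply/eqP; ring.
  lra.
apply: le_trans step _.
have ih : i%:R * h <= t - s by rewrite -nh ler_pM2r// ler_nat.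
have p1 : (1 + L * h) ^+ i <= expR (L * (t - s)).
  apply: (@le_trans _ _ (expR (L * h) ^+ i)).
    apply: lerXn2r; rewrite ?nnegrE ?expR_ge0 ?expR_ge1Dx//.
    by rewrite addr_ge0// mulr_ge0// ltW.
  by rewrite -expRM_natl ler_expR mulrCA ler_wpM2l// mulrC.
rewrite (_ : B * h ^+ 2 * i%:R * _ = B * (i%:R * h) * (1 + L * h) ^+ i * h); last by ring.
rewrite ler_pM2r//; apply: ler_pM => //.
- by rewrite mulr_ge0// mulr_ge0// ltW.
- by rewrite exprn_ge0// addr_ge0// mulr_ge0// ltW.
- by rewrite ler_wpM2l.
Qed.

End Euler.
End Solution.

(** * Entropy and dissipation along the Euler scheme *)

Section EntropyDissipation.
Context {R : realType}.
Variables (K : int -> int -> R) (C : R).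
Hypotheses (K_gt0 : forall k l, 0 < K k l) (K_le : forall k l, K k l <= C).
Variable m : int -> R.
Hypotheses (m_gt0 : forall k, 0 < m k) (sm : summ m) (m1 : rsum m = 1).
Hypothesis m_db : detailed_balance K m.

Definition entropy_term (g : int -> R) (k : int) : R := m k * phi (g k / m k).

(** The formal limit, as the step tends to 0, of the Bregman terms in [entropy_step], where
    [post_density] becomes [prod_density]. *)
Definition diss_term (g : int -> R) (x : int * int) : R :=
  coll_weight K m x * breg (prod_density m g (collide x)) (prod_density m g x).

Lemma entropy_term_ge0 g k : 0 <= g k -> 0 <= entropy_term g k.
Proof.
move=> g0; have m0 := ltW (m_gt0 k).
by rewrite mulr_ge0// phi_ge0// divr_ge0.
Qed.

Lemma diss_term_ge0 g x : 0 <= diss_term g x.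
Proof. by rewrite mulr_ge0 ?breg_ge0// (ltW (coll_weight_gt0 K_gt0 m_gt0 x)). Qed.

(** The summand [g k * ln (g k / m k)] is [entropy_term g k + g k - m k], and both corrections have
    total mass 1. This covers infinite entropy too. *)
Lemma rel_entropyE g : prob_vec g -> rel_entropy g m = esumT (entropy_term g).
Proof.
move=> [g0 sg g1].
have e0 k := entropy_term_ge0 (g0 k).
have mE : esumT m = 1%E by rewrite -rsum_ge0E ?m1// => k; exact: ltW.
rewrite /rel_entropy /zsum (@esumT_posneg _ _ _ (fun k => entropy_term g k + g k) m).
- by rewrite esumTD// -(rsum_ge0E g0 sg) g1 mE addeK.
- by move=> k; rewrite addr_ge0.
- by move=> k; exact: ltW.
- move=> k; rewrite /entropy_term /phi.
  have : m k * (g k / m k) = g k by rewrite mulrCA divff ?mulr1// gt_eqF.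
  by move: (g k / m k) => r <-; ring.
- by rewrite mE ltry.
Qed.

(** With [x = pair_of p], the two fluxes in the summand of [dissipation] at [p] are those at [x] and
    at [collide x]. *)
Let pair_of (p : int * int) : int * int := (p.2 + 1, p.1).

Let bij_pair_of : bijective pair_of.
Proof.
exists (fun x => (x.2, x.1 - 1)) => -[a b] /=; rewrite /pair_of /= ?addrK ?subrK//.
Qed.

(** A summand of [dissipation] is [diss_term] at [x] plus [diss_term] at [collide x]; as [collide]
    is a bijection, the total is doubled, which cancels the factor 1/2. Where a density vanishes,
    both sides are 0 by the default values of [ln] and of division. *)
Lemma dissipationE g : (forall k, 0 <= g k) ->
  dissipation K g = esumT (diss_term g).
Proof.
move=> g0; set u := prod_density m g.
have u0 x : 0 <= u x by rewrite mulr_ge0 ?divr_ge0// ltW.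
pose E x := diss_term g x + diss_term g (collide x).
have cE x : K x.1 x.2 * g x.1 * g x.2 = coll_weight K m x * u x.
  by rewrite coll_weight_density// mulrA.
have EE p : E (pair_of p) =
  (jflux K g (p.2 + 1) p.1 - jflux K g (p.1 + 1) p.2) *
       ln (jflux K g (p.2 + 1) p.1 / jflux K g (p.1 + 1) p.2).
  set x := pair_of p.
  have -> : jflux K g (p.2 + 1) p.1 = coll_weight K m x * u x by rewrite -cE.
  have -> : jflux K g (p.1 + 1) p.2 = coll_weight K m x * u (collide x).
    by rewrite -(coll_weight_collide m_db) -cE /x /pair_of /collide /= addrK.
  have c0 : 0 < coll_weight K m x by exact: coll_weight_gt0.
  rewrite /E /diss_term collideK (coll_weight_collide m_db) -/u /breg andbC.
  have [ux|ux] := ltP 0 (u x); last first.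
    have -> : u x = 0 by apply/eqP; rewrite eq_le ux u0.
    by rewrite !(mul0r, mulr0) ln0// mulr0 addr0.
  have [uc|uc] := ltP 0 (u (collide x)); last first.
    have -> : u (collide x) = 0 by apply/eqP; rewrite eq_le uc u0.
    by rewrite !(mulr0, invr0) ln0// mulr0 addr0.
  have a1 := mulr_gt0 c0 ux; have a2 := mulr_gt0 c0 uc.
  rewrite /= ln_div ?posrE//.
  have -> : ln (coll_weight K m x * u x) = ln (coll_weight K m x) + ln (u x).
    by rewrite lnM ?posrE.
  have -> : ln (coll_weight K m x * u (collide x)) =
      ln (coll_weight K m x) + ln (u (collide x)) by rewrite lnM ?posrE.
  ring.
rewrite /dissipation.
have -> : (\esum_(p in [set: int * int])
     ((jflux K g (p.2 + 1) p.1 - jflux K g (p.1 + 1) p.2) *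
       ln (jflux K g (p.2 + 1) p.1 / jflux K g (p.1 + 1) p.2))%:E
   = esumT (diss_term g) + esumT (diss_term g))%E.
  transitivity (esumT (E \o pair_of)); first by apply: eq_esum => p _; rewrite /= EE.
  have bE : set_bij setT setT pair_of by rewrite setTT_bijective.
  have bC : set_bij setT setT collide by rewrite setTT_bijective; exact: bij_collide.
  rewrite /esumT /= -(reindex_esum _ _ _ (fun x => (E x)%:E) bE).
  rewrite -[X in (_ + X)%E](esym (reindex_esum _ _ _ _ bC)).
  rewrite -[LHS]/(esumT E) /E esumTD//; first by move=> x; exact: diss_term_ge0.
  by move=> x; exact: diss_term_ge0.
set X := esumT _; have : (0 <= X)%E by apply: esumT_ge0 => x; exact: diss_term_ge0.
case: X => [r| |]//=; last by rewrite mulry gtr0_sg ?invr_gt0// mul1e.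
by move=> _; rewrite -EFinD -EFinM; congr EFin; field.
Qed.

(** At [x = 0] the graph of [phi] has a vertical tangent. The tangent at [e] serves instead: its
    value at 0 is [1 - e], that is [phi 0 - e]. *)
Lemma phi_affine_minorant (x e : R) : 0 <= x -> 0 < e ->
  exists L : R, forall a, 0 <= a -> phi x - e + L * (a - x) <= phi a.
Proof.
move=> x0 e0; move: x0; rewrite le_eqVlt => /predU1P[<-|x0].
  exists (ln e) => a a0; have := phi_tangent e0 a0; have := breg_ge0 a e.
  by rewrite phi0 /phi; lra.
exists (ln x) => a a0; have := phi_tangent x0 a0; have := breg_ge0 a x.
lra.
Qed.

Lemma entropy_lsc (g : int -> R) (s : seq int) (e : R) :
  (forall k, 0 <= g k) -> 0 < e -> uniq s ->
  exists2 d : R, 0 < d & forall g', prob_vec g' ->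
   (forall k, `|g' k - g k| <= d) ->
   \sum_(k <- s) entropy_term g k <= \sum_(k <- s) entropy_term g' k + e.
Proof.
move=> g0 e0 us; have e20 : 0 < e / 2 by rewrite divr_gt0.
have gm0 k : 0 <= g k / m k by rewrite divr_ge0// ltW.
pose L k := sval (cid (phi_affine_minorant (gm0 k) e20)).
have HL k : forall a, 0 <= a -> phi (g k / m k) - e / 2 + L k * (a - g k / m k) <= phi a.
  exact: (svalP (cid (phi_affine_minorant (gm0 k) e20))).
pose B := \sum_(k <- s) `|L k|.
have B0 : 0 <= B by exact: sumr_ge0.
(* The minorants lose at most [e / 2] in total, as [m] has mass 1. In the slope terms the weight
   [m k] cancels against the density, so this distance costs another [e / 2]. *)
exists (e / 2 / (1 + B)); first by rewrite divr_gt0// ltr_pwDl.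
move=> g' [g'0 sg' g'1] close.
have pt k : entropy_term g k <= entropy_term g' k + m k * (e / 2) + `|L k| * (e / 2 / (1 + B)).
  have := HL k (g' k / m k); rewrite divr_ge0 ?(ltW (m_gt0 k))// => /(_ isT) H.
  have {H} := ler_wpM2l (ltW (m_gt0 k)) H.
  have -> : m k * (phi (g k / m k) - e / 2 + L k * (g' k / m k - g k / m k)) =
     m k * phi (g k / m k) - m k * (e / 2) + L k * (g' k - g k).
    by field; rewrite gt_eqF.
  rewrite -!/(entropy_term _ _).
  have : - (L k * (g' k - g k)) <= `|L k| * (e / 2 / (1 + B)).
    by rewrite (le_trans (ler_norm _))// normrN normrM ler_wpM2l.
  lra.
apply: (@le_trans _ _ (\sum_(k <- s) (entropy_term g' k + m k * (e / 2)
   + `|L k| * (e / 2 / (1 + B))))).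
  exact: ler_sum.
rewrite !big_split/= -addrA lerD2l -!mulr_suml -/B.
have : \sum_(k <- s) m k <= 1.
  by rewrite -m1; apply: (sum_le_rsum (a := m)) => // k; exact: ltW.
have : B * (e / 2 / (1 + B)) <= e / 2.
  by rewrite mulrCA ler_piMr ?ltW// ltr_pdivrMr ?mul1r ?ltr_pwDl// ltrDr.
have := ltW e20; set S := \sum_(k <- s) m k; nra.
Qed.

Lemma euler_entropy (h : R) (g : int -> R) (n : nat) (t : seq (int * int)) :
  0 < h -> 2 * h * C < 1 -> prob_vec g -> summ (entropy_term g) -> uniq t ->
  summ (entropy_term (euler K h g n)) /\
  rsum (entropy_term (euler K h g n))
   + \sum_(i < n) h * \sum_(x <- t) coll_weight K m x *
      breg (prod_density m (euler K h g i) (collide x))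
           (post_density K m h (euler K h g i) x)
  <= rsum (entropy_term g).
Proof.
move=> h0 hC dg sg ut; elim: n => [|n [sn IH]]; first by rewrite big_ord0 addr0.
have [p0 sp p1] := euler_prob_vec K_gt0 K_le n h0 hC dg.
have [q0 sq q1] := euler_prob_vec K_gt0 K_le n.+1 h0 hC dg.
have step s (us : uniq s) := entropy_step K_gt0 K_le m_gt0 sm m1 m_db p0 sp p1 h0 hC sn us ut.
set w := h * _ in step.
have w0 : 0 <= w.
  rewrite mulr_ge0 ?(ltW h0)// sumr_ge0// => x _.
  by rewrite mulr_ge0 ?breg_ge0// ltW ?coll_weight_gt0.
have e0 k := entropy_term_ge0 (q0 k).
(* The bound is uniform in [s], so it first proves the entropy of the next iterate finite and then
   estimates it. *)
have bnd s : uniq s -> \sum_(k <- s) entropy_term (euler K h g n.+1) k <=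
    rsum (entropy_term (euler K h g n)) - w.
  by move=> /step; rewrite -/(entropy_term _) lerBrDr; exact.
have sn1 : summ (entropy_term (euler K h g n.+1)).
  apply: (summ_bounded (M := rsum (entropy_term (euler K h g n)) - w)) => s us.
  by under eq_bigr => k _ do rewrite ger0_norm//; exact: bnd.
split=> //; rewrite big_ord_recr/= -/w.
have := rsum_le e0 sn1 bnd; lra.
Qed.

End EntropyDissipation.

(** * Passage to the limit *)

Section Limits.
Context {R : realType}.

Lemma le_limn_einf (u v : (\bar R)^nat) : (forall n, (u n <= v n)%E) ->
  (limn_einf u <= limn_einf v)%E.
Proof.
move=> uv; rewrite !limn_einf_lim; apply: lee_lim; [exact: is_cvg_einfs..|].
apply: nearW => n; apply: le_ereal_inf_tmp => _ [k /= nk <-].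
by apply: le_trans (uv k); apply: ereal_inf_lbound; exists k.
Qed.

Lemma limn_einf_le (u : (\bar R)^nat) b : (forall n, (u n <= b)%E) ->
  (limn_einf u <= b)%E.
Proof.
move=> ub; have cb : (fun _ : nat => b) @ \oo --> b by exact: cvg_cst.
by rewrite -(cvg_limn_einf_sup cb).1; exact: le_limn_einf.
Qed.

(** Monotone convergence along the enumeration of [T] by [pickle_inv]; integers that code no element
    contribute 0. *)
Lemma integral_esumT_le (d : measure_display) (X : measurableType d)
    (mu : {measure set X -> \bar R}) (D : set X) (T : countType)
    (F : X -> T -> R) (M : \bar R) : measurable D ->
  (forall t x, 0 <= F t x) -> (forall x, measurable_fun D (fun t => F t x)) ->
  (forall s : seq T, uniq s ->
     (\int[mu]_(t in D) (\sum_(x <- s) F t x)%:E <= M)%E) ->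
  (\int[mu]_(t in D) esumT (F t) <= M)%E.
Proof.
move=> mD F0 mF FM.
pose G t (n : nat) : R := oapp (F t) 0 (@pickle_inv T n).
have G0 t n : 0 <= G t n by rewrite /G; case: pickle_inv => /=.
have mG (n : nat) : measurable_fun D (EFin \o (fun t => G t n)).
  by apply/measurable_EFinP; rewrite /G; case: pickle_inv => /=.
have sumG t n : \sum_(0 <= i < n) G t i =
    \sum_(x <- pmap (@pickle_inv T) (index_iota 0 n)) F t x.
  elim: index_iota => [|i r IH]; first by rewrite !big_nil.
  by rewrite big_cons IH /G /=; case: pickle_inv => [x|]/=; rewrite ?big_cons ?add0r.
have uS n : uniq (pmap (@pickle_inv T) (index_iota 0 n)).
  by apply: pmap_uniq (iota_uniq _ _); exact: pickle_invK.
have sumM n : (\sum_(0 <= i < n) \int[mu]_(t in D) (G t i)%:E <= M)%E.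
  rewrite -ge0_integral_sum//; last by move=> i t _; rewrite lee_fin.
  apply: le_trans (FM _ (uS n)); rewrite le_eqVlt; apply/orP; left; apply/eqP.
  by apply: eq_integral => t _; rewrite sumEFin sumG.
apply: (@le_trans _ _ (\int[mu]_(t in D) \sum_(0 <= n <oo) (G t n)%:E)%E).
  rewrite le_eqVlt; apply/orP; left; apply/eqP; apply: eq_integral => t _.
  rewrite nneseries_esumT; last by move=> n; rewrite lee_fin.
  pose P : set nat := range (@pickle T).
  rewrite (esumID P)/=; last by move=> n _; rewrite lee_fin.
  rewrite [X in (_ + X)%E]esum1 ?adde0; last first.
    move=> n [_ nP]; rewrite /G; case E : pickle_inv => [x|]//.
    exfalso; apply: nP; exists x => //.
    by have := @pickle_invK T n; rewrite E.
  rewrite setTI /P esum_image; last by move=> x y _ _; exact: (pcan_inj pickleK_inv).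
  by apply: eq_esum => x _; rewrite /G pickleK_inv.
rewrite integral_nneseries//; last by move=> n t _; rewrite lee_fin.
apply: lime_le; last by apply: nearW => n; exact: sumM.
apply: is_cvg_nneseries => n _ _; apply: integral_ge0 => t _.
by rewrite lee_fin.
Qed.

Lemma measurable_breg (d : measure_display) (X : measurableType d) (a b : X -> R) :
  measurable_fun setT a -> measurable_fun setT b ->
  measurable_fun setT (fun t => breg (a t) (b t)).
Proof.
move=> ma mb; apply: measurable_fun_ifT.
- by apply: measurable_and; exact: measurable_fun_ltr.
- apply: measurable_funD => //; apply: measurable_funB => //.
  apply: measurable_funM => //; apply: measurable_funB.
    exact: measurableT_comp (@measurable_ln R) ma.
  exact: measurableT_comp (@measurable_ln R) mb.
- exact: measurable_cst.
Qed.

Lemma cvg_breg (a b : R^nat) (a0 b0 : R) : 0 < a0 -> 0 < b0 ->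
  a n @[n --> \oo] --> a0 -> b n @[n --> \oo] --> b0 ->
  breg (a n) (b n) @[n --> \oo] --> breg a0 b0.
Proof.
move=> a00 b00 ca cb.
have la : ln (a n) @[n --> \oo] --> ln a0.
  exact: (cvg_comp _ _ ca (continuous_ln a00)).
have lb : ln (b n) @[n --> \oo] --> ln b0.
  exact: (cvg_comp _ _ cb (continuous_ln b00)).
have c : a n * (ln (a n) - ln (b n)) - a n + b n @[n --> \oo] -->
    a0 * (ln a0 - ln b0) - a0 + b0.
  by apply: cvgD => //; apply: cvgB => //; apply: cvgM => //; exact: cvgB.
rewrite {2}/breg a00 b00 /=; apply: cvg_trans c; apply: near_eq_cvg.
near=> n; rewrite /breg ifT//; apply/andP; split; near: n.
- exact: cvgr_gt ca _ a00.
- exact: cvgr_gt cb _ b00.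
Unshelve. all: by end_near. Qed.

Lemma cvg_sum_seq (I : Type) (r : seq I) (u : I -> R^nat) (l : I -> R) :
  (forall i, u i n @[n --> \oo] --> l i) ->
  \sum_(i <- r) u i n @[n --> \oo] --> \sum_(i <- r) l i.
Proof.
move=> ul; elim: r => [|i r IH].
  by rewrite big_nil; under eq_fun do rewrite big_nil; exact: cvg_cst.
by rewrite big_cons; under eq_fun do rewrite big_cons; exact: cvgD.
Qed.

Section DissipationLimit.
Variables (K : int -> int -> R) (m : int -> R).
Hypotheses (K_gt0 : forall k l, 0 < K k l) (m_gt0 : forall k, 0 < m k).

Lemma cvg_prod_density (g_ : nat -> int -> R) (g : int -> R) x :
  (forall k, g_ n k @[n --> \oo] --> g k) ->
  prod_density m (g_ n) x @[n --> \oo] --> prod_density m g x.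
Proof. by move=> cg; apply: cvgM; apply: cvgMl. Qed.

(** [breg] is continuous at positive arguments; otherwise the limit term is 0 by default and the
    minorant 0 works. Convergent minorants can be added over a finite list of pairs. *)
Lemma diss_term_lsc (g_ : nat -> int -> R) (g : int -> R) (h_ : R^nat) x :
  (forall k, g_ n k @[n --> \oo] --> g k) -> h_ n @[n --> \oo] --> (0 : R) ->
  exists2 b : R^nat, b n @[n --> \oo] --> diss_term K m g x &
   forall n, b n <= coll_weight K m x *
     breg (prod_density m (g_ n) (collide x)) (post_density K m (h_ n) (g_ n) x).
Proof.
move=> cg ch; have c0 := coll_weight_gt0 K_gt0 m_gt0 x.
have cu y : prod_density m (g_ n) y @[n --> \oo] --> prod_density m g y.
  exact: cvg_prod_density.
have cv : post_density K m (h_ n) (g_ n) x @[n --> \oo] --> prod_density m g x.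
  have -> : prod_density m g x = (1 - 0 * K x.1 x.2 - 0 * K x.2 x.1) * prod_density m g x
    + 0 * K x.1 x.2 * prod_density m g (collide x)
    + 0 * K x.2 x.1 * prod_density m g (collide (swap_pair x)) by ring.
  have chK k l : h_ n * K k l @[n --> \oo] --> 0 * K k l by exact: cvgMl.
  apply: cvgD; [apply: cvgD|]; apply: cvgM => //.
  by apply: cvgB => //; apply: cvgB => //; exact: cvg_cst.
have [/andP[u1 u2]|nu] := boolP ((0 < prod_density m g (collide x)) && (0 < prod_density m g x)).
  exists (fun n => coll_weight K m x *
     breg (prod_density m (g_ n) (collide x)) (post_density K m (h_ n) (g_ n) x)) => //.
  by apply: cvgMr; exact: cvg_breg.
exists (fun=> 0) => [|n]; last by rewrite mulr_ge0 ?breg_ge0// ltW.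
by rewrite /diss_term /breg (negPf nu) mulr0; exact: cvg_cst.
Qed.

End DissipationLimit.
End Limits.

(** * The entropy inequality for the solution *)

Section EntropyInequality.
Context {R : realType}.
Variables (K : int -> int -> R) (C : R).
Hypotheses (K_gt0 : forall k l, 0 < K k l) (K_le : forall k l, K k l <= C).
Variable m : int -> R.
Hypotheses (m_gt0 : forall k, 0 < m k) (sm : summ m) (m1 : rsum m = 1).
Hypothesis m_db : detailed_balance K m.
Variables (f : R -> int -> R) (df : R -> int -> R).
Hypotheses (sf : forall t : R, 0 <= t -> summ (f t)).
Hypotheses (sdf : forall t : R, 0 <= t -> summ (df t)).
Hypothesis f_diff : forall t : R, 0 <= t -> forall e : R, 0 < e ->
  exists2 d : R, 0 < d & forall s : R, 0 <= s -> `|s - t| < d ->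
    norm1 (fun k => f s k - f t k - (s - t) * df t k) <= e * `|s - t|.
Hypothesis f_eq : forall t : R, 0 < t -> df t = collision K (f t).

Let C_gt0 : 0 < C. Proof. exact: lt_le_trans (K_gt0 0 0) (K_le 0 0). Qed.

Lemma euler_close (s t : R) : 0 <= s -> s < t -> prob_vec (f s) ->
  forall e : R, 0 < e -> exists N, forall n, (N <= n)%N ->
  let h := (t - s) / n%:R in
  [/\ (0 < n)%N, 2 * h * C < 1, h <= e & forall i, (i <= n)%N ->
  norm1 (fun k => f (s + i%:R * h) k - euler K h (f s) i k) <= e].
Proof.
move=> s0 st ps e e0.
have [D D0 HD] := euler_error K_gt0 K_le sf sdf f_diff f_eq s0 st ps.
have T0 : 0 < t - s by rewrite subr_gt0.
(* For [n] above [X], both [(D + 1) * h < e] and [2 * h * C < 1] hold; the first bounds the error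
   [D * h] as well as [h] itself. *)
pose X := (t - s) * ((D + 1) / e + 2 * C).
have X0 : 0 < X by rewrite mulr_gt0// addr_gt0 ?divr_gt0 ?mulr_gt0// ltr_wpDl.
exists (Num.bound X) => n nN h.
have Xn : X < n%:R.
  by apply: lt_le_trans (archi_boundP (ltW X0)) _; rewrite ler_nat.
have nR : 0 < n%:R :> R by exact: lt_trans X0 Xn.
have n0 : (0 < n)%N by rewrite -(ltr0n R).
have h0 : 0 < h by rewrite divr_gt0.
have nh : n%:R * h = t - s by rewrite /h mulrC divfK// gt_eqF.
have De : (D + 1) * (t - s) < e * n%:R.
  rewrite -ltr_pdivrMl//; apply: le_lt_trans Xn; rewrite /X.
  have : 0 <= (t - s) * (2 * C) by rewrite !mulr_ge0// ltW.
  have -> : e^-1 * ((D + 1) * (t - s)) = (t - s) * ((D + 1) / e) by ring.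
  lra.
have C1 : 2 * C * (t - s) < n%:R.
  apply: le_lt_trans Xn; rewrite /X.
  have : 0 <= (t - s) * ((D + 1) / e).
    by rewrite mulr_ge0 ?(ltW T0)// divr_ge0 ?addr_ge0 ?(ltW e0).
  lra.
have hC : 2 * h * C < 1.
  by rewrite /h mulrA mulrAC ltr_pdivrMr// mul1r; apply: le_lt_trans C1; rewrite mulrAC.
have Dh : (D + 1) * h < e by rewrite /h mulrA ltr_pdivrMr.
split => //.
  by apply: le_trans (ltW Dh); rewrite ler_peMl ?(ltW h0)// lerDr.
move=> i ilen; apply: le_trans (HD n n0 hC i ilen) _.
by apply: le_trans (ltW Dh); rewrite ler_wpM2r ?(ltW h0)// lerDl.
Qed.

Lemma solution_prob (t : R) : prob_vec (f 0) -> 0 <= t -> prob_vec (f t).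
Proof.
move=> p0; rewrite le_eqVlt => /predU1P[<-//|t0].
have approx (e : R) : 0 < e -> exists2 g, prob_vec g & norm1 (fun k => f t k - g k) <= e.
  move=> e0; have [N /(_ N (leqnn N))[N0 hC _ /(_ N (leqnn N))]] :=
    euler_close (lexx 0) t0 p0 e0.
  set h := _ / _ in hC *; have h0 : 0 < h by rewrite divr_gt0 ?subr_gt0 ?ltr0n.
  rewrite add0r mulrC divfK ?gt_eqF ?ltr0n// subr0 => H.
  by exists (euler K h (f 0) N) => //; exact: euler_prob_vec.
have st := sf (ltW t0); split => //.
- move=> k; apply/ler_addgt0Pr => e e0; have [g [g0 sg _] H] := approx e e0.
  have := ler_norm1 k (summB st sg); have := g0 k; have := ler_norm (g k - f t k).
  by rewrite distrC; lra.
- apply/eqP; rewrite -subr_eq0 -normr_le0; apply/ler_addgt0Pr => e e0.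
  have [g [g0 sg <-] H] := approx e e0; rewrite add0r -rsumB//.
  by apply: le_trans H; apply: ler_norm_rsum; exact: summB.
Qed.

(** [f] is constrained only at nonnegative times; the absolute value extends it continuously to the
    whole line, where measurability follows. *)
Lemma continuous_solution k : continuous (fun t : R => f `|t| k).
Proof.
move=> t; have [d d0 H] := norm1_continuous sf sdf f_diff (normr_ge0 t).
have n0 := norm1_ge0 (sdf (normr_ge0 t)).
apply/cvgrPdist_le => e e0.
have D1 : 0 < 1 + norm1 (df `|t|) by rewrite ltr_pwDl.
have m0 : 0 < Num.min d (e / (1 + norm1 (df `|t|))) by rewrite lt_min d0 divr_gt0.
apply/nbhs_ballP; exists (Num.min d (e / (1 + norm1 (df `|t|)))) => //= y.
rewrite /ball/= distrC lt_min => /andP[yd ye].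
have dist' : `| `|y| - `|t| | <= `|y - t| by exact: ler_dist_dist.
have := H `|y| (normr_ge0 y) (le_lt_trans dist' yd).
have sfy := sf (normr_ge0 y); have sft := sf (normr_ge0 t).
have := ler_norm1 k (summB sfy sft); rewrite [in X in _ -> _ -> X]distrC => H1 H2.
apply: le_trans H1 _; apply: le_trans H2 _.
rewrite mulrC -ler_pdivlMr//; exact: le_trans dist' (ltW ye).
Qed.

Lemma measurable_diss_term x :
  measurable_fun setT (fun t : R => diss_term K m (f `|t|) x).
Proof.
have mf k : measurable_fun setT (fun t : R => f `|t| k).
  by apply: continuous_measurable_fun; exact: continuous_solution.
have mu y : measurable_fun setT (fun t : R => prod_density m (f `|t|) y).
  by apply: measurable_funM; apply: measurable_funM; try exact: mf; exact: measurable_cst.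
by apply: measurable_funM => //; exact: measurable_breg.
Qed.

Lemma entropy_dissipation_bound (s t : R) (A : seq int) (S : seq (int * int)) :
  0 <= s -> s < t -> prob_vec (f s) -> summ (entropy_term m (f s)) ->
  prob_vec (f t) -> uniq A -> uniq S ->
  (\int[lebesgue_measure]_(tau in `[s, t])
      (\sum_(x <- S) diss_term K m (f `|tau|) x)%:E
    <= (rsum (entropy_term m (f s)) - \sum_(k <- A) entropy_term m (f t) k)%:E)%E.
Proof.
move=> s0 st ps sH [ft0 _ _] uA uS; apply/lee_addgt0Pr => e e0.
have T0 : 0 < t - s by rewrite subr_gt0.
have [d d0 Hd] := entropy_lsc m_gt0 sm m1 ft0 e0 uA.
have [N HN] := euler_close s0 st ps d0.
pose n j := (j + N)%N; pose h j : R := (t - s) / (n j)%:R.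
have nP j : (0 < n j)%N by case: (HN (n j) (leq_addl _ _)).
have nR j : 0 < (n j)%:R :> R by rewrite ltr0n.
have hC j : 2 * h j * C < 1 by case: (HN (n j) (leq_addl _ _)).
have h0 j : 0 < h j by rewrite divr_gt0.
have nh j : (n j)%:R * h j = t - s by rewrite /h mulrC divfK// gt_eqF.
pose E j i := euler K (h j) (f s) i.
have pE j i : prob_vec (E j i) by exact: euler_prob_vec.
pose w j i := \sum_(x <- S) coll_weight K m x *
  breg (prod_density m (E j i) (collide x)) (post_density K m (h j) (E j i) x).
have w0 j i : 0 <= w j i.
  apply: sumr_ge0 => x _; rewrite mulr_ge0 ?breg_ge0//.
  exact: ltW (coll_weight_gt0 K_gt0 m_gt0 x).
(* Closed intervals overlap at grid points, where [G] adds two values. This is harmless: pointwise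
   only a lower bound on [G] is used, and each interval still has length [h j]. *)
pose I j i : set R := `[s + i%:R * h j, s + i.+1%:R * h j]%classic.
pose G j (tau : R) := (\sum_(i <- iota 0 (n j)) (w j i)%:E * (\1_(I j i) tau)%:E)%E.
have mI j i : measurable (I j i) by exact: measurable_itv.
have mD : measurable (`[s, t]%classic : set R) by exact: measurable_itv.
have mGi j i : measurable_fun `[s, t] (fun tau : R => ((w j i)%:E * (\1_(I j i) tau)%:E)%E).
  apply/measurable_EFinP; apply: measurable_funM; first exact: measurable_cst.
  exact: measurable_indic.
have mG j : measurable_fun `[s, t] (G j) by exact: emeasurable_sum.
have m1I j i : measurable_fun `[s, t] (fun tau : R => (\1_(I j i) tau)%:E).
  by apply/measurable_EFinP; exact: measurable_indic.
have Gi0 j i (tau : R) : (0 <= (w j i)%:E * (\1_(I j i) tau)%:E)%E.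
  by rewrite mule_ge0// lee_fin.
have G0 j tau : (0 <= G j tau)%E.
  by apply: sume_ge0 => i _; exact: Gi0.
have intG j : (\int[lebesgue_measure]_(tau in `[s, t]) G j tau <=
   (rsum (entropy_term m (f s)) - \sum_(k <- A) entropy_term m (f t) k + e)%:E)%E.
  rewrite ge0_integral_sum//; [|exact: mGi].
  have [sE HE] := euler_entropy K_gt0 K_le m_gt0 sm m1 m_db (n j) (h0 j) (hC j) ps sH uS.
  apply: (@le_trans _ _ (\sum_(i < n j) h j * w j i)%:E).
    rewrite -sumEFin -(big_mkord xpredT (fun i => (h j * w j i)%:E)) /index_iota subn0.
    apply: lee_sum => i _.
    have -> : (\int[lebesgue_measure]_(tau in `[s, t]) ((w j i)%:E * (\1_(I j i) tau)%:E) =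
        (w j i)%:E * \int[lebesgue_measure]_(tau in `[s, t]) (\1_(I j i) tau)%:E)%E.
      by apply: ge0_integralZl_EFin => //; exact: m1I.
    have -> : (\int[lebesgue_measure]_(tau in `[s, t]) (\1_(I j i) tau)%:E =
        lebesgue_measure (I j i `&` `[s, t]))%E.
      by apply: integral_indic; [exact: mD|exact: mI].
    rewrite muleC EFinM lee_wpmul2r ?lee_fin//.
    apply: (@le_trans _ _ (lebesgue_measure (I j i))).
      apply: le_measure; rewrite ?inE.
      - by apply: measurableI; [exact: mI|exact: mD].
      - exact: mI.
      - exact: subIsetl.
    rewrite lebesgue_measure_itv/= lte_fin ltrD2l ltr_pM2r// ltr_nat ltnSn.
    by rewrite -EFinD lee_fin -natr1; lra.
  have pn := pE j (n j); have [q0 sq q1] := pn.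
  have close k : `|E j (n j) k - f t k| <= d.
    have [_ _ _ /(_ (n j) (leqnn _))] := HN (n j) (leq_addl _ _).
    rewrite -/(h j) nh addrC subrK => H; apply: le_trans H.
    by rewrite distrC; apply: ler_norm1 (summB (sf _) sq); rewrite (le_trans s0)// ltW.
  have H1 := Hd _ pn close.
  have H2 : \sum_(k <- A) entropy_term m (E j (n j)) k <= rsum (entropy_term m (E j (n j))).
    by apply: sum_le_rsum => // k; exact: entropy_term_ge0.
  by rewrite lee_fin; move: HE H1 H2; rewrite /w /E; lra.
have hcv : h j @[j --> \oo] --> (0 : R).
  apply/cvgrPdist_le => e' e'0; have [N' HN'] := euler_close s0 st ps e'0.
  near=> j; rewrite sub0r normrN gtr0_norm//.
  have [//|_ _ + _] := HN' (n j); last exact.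
  by apply: leq_trans (leq_addr _ _); near: j; exact: nbhs_infty_ge.
have key tau : `[s, t]%classic tau ->
   ((\sum_(x <- S) diss_term K m (f `|tau|) x)%:E <= limn_einf (G ^~ tau))%E.
  rewrite /= in_itv/= => /andP[stau taut].
  have tau0 : 0 <= tau by exact: le_trans stau.
  have idx j : exists i, (i < n j)%N /\ I j i tau.
    have x0 : 0 <= (tau - s) / h j by rewrite divr_ge0 ?subr_ge0// ltW.
    have xn : (tau - s) / h j <= (n j)%:R by rewrite ler_pdivrMr// nh lerD2r.
    have xE : (tau - s) / h j * h j = tau - s by rewrite divfK// gt_eqF.
    have mem i : i%:R <= (tau - s) / h j -> (tau - s) / h j <= i.+1%:R -> I j i tau.
      rewrite -[i%:R <= _](ler_pM2r (h0 j)) -[_ <= i.+1%:R](ler_pM2r (h0 j)) xE.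
      by move=> H1 H2; rewrite /I /= in_itv/=; apply/andP; split; lra.
    have /andP[t1 t2] := truncn_itv x0.
    have [lt|ge] := ltnP (Num.truncn ((tau - s) / h j)) (n j).
      by exists (Num.truncn ((tau - s) / h j)); split => //; apply: mem => //; exact: ltW.
    (* The quotient reaches [n j] only at [tau = t], which belongs to the last interval. *)
    exists (n j).-1; rewrite prednK//; split => //; apply: mem; rewrite ?prednK//.
    by apply: le_trans t1; rewrite ler_nat (leq_trans _ ge)// leq_pred.
  pose i j := sval (cid (idx j)).
  have [ilt iI] : (forall j, (i j < n j)%N) /\ (forall j, I j (i j) tau).
    by split=> j; case: (svalP (cid (idx j))).
  have cE k : E j (i j) k @[j --> \oo] --> f `|tau| k.
    apply/cvgrPdist_le => e' e'0; rewrite ger0_norm//.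
    have [d1 d10 H1] := norm1_continuous sf sdf f_diff tau0.
    have n0 := norm1_ge0 (sdf tau0).
    have D1 : 0 < 1 + norm1 (df tau) by rewrite ltr_pwDl.
    have e20 : 0 < e' / 2 by rewrite divr_gt0.
    (* One half of [e'] is for the error of the scheme, the other for moving from the grid time
       [sig] to [tau], at distance at most [h j]; [d1 / 2] keeps [sig] within the range of the
       Lipschitz bound at [tau]. *)
    pose e'' := Num.min (e' / 2) (Num.min (d1 / 2) (e' / 2 / (1 + norm1 (df tau)))).
    have e''0 : 0 < e'' by rewrite !lt_min e20 !divr_gt0.
    have [N' HN'] := euler_close s0 st ps e''0.
    near=> j.
    have [|_ _ he /(_ (i j) (ltnW (ilt j)))] := HN' (n j).
      by apply: leq_trans (leq_addr _ _); near: j; exact: nbhs_infty_ge.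
    rewrite -/(h j) in he *; set sig := s + _ => H2.
    have sig0 : 0 <= sig by rewrite addr_ge0// mulr_ge0// ltW.
    have sigtau : `|sig - tau| <= h j.
      have := iI j; rewrite /I /= in_itv/= -/sig -natr1 => /andP[a1 a2].
      rewrite ler_norml; apply/andP; split; last by have := h0 j; lra.
      by move: a2; rewrite /sig; lra.
    move: (he); rewrite !le_min => /and3P[he1 he2 he3].
    move: (H2); rewrite !le_min => /and3P[H21 _ _].
    have [_ sEj _] := pE j (i j).
    have sd : `|sig - tau| < d1.
      apply: le_lt_trans sigtau _; apply: le_lt_trans he2 _.
      by rewrite ltr_pdivrMr// ltr_pMr// ltr1n.
    have H3 := H1 sig sig0 sd.
    have H4 : (1 + norm1 (df tau)) * `|sig - tau| <= e' / 2.
      by rewrite mulrC -ler_pdivlMr//; exact: le_trans sigtau he3.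
    have H5 := ler_norm1 k (summB (sf sig0) (sf tau0)).
    have H6 := ler_norm1 k (summB (sf sig0) sEj).
    have -> : f tau k - E j (i j) k = (f sig k - E j (i j) k) - (f sig k - f tau k) by ring.
    by apply: le_trans (ler_normB _ _) _; rewrite /= in H5 H6; lra.
  have bx x := diss_term_lsc K_gt0 m_gt0 x cE hcv.
  pose b x := s2val (cid2 (bx x)).
  have bcv x : b x j @[j --> \oo] --> diss_term K m (f `|tau|) x by exact: (s2valP (cid2 (bx x))).
  have ble x j : b x j <= coll_weight K m x *
     breg (prod_density m (E j (i j)) (collide x)) (post_density K m (h j) (E j (i j)) x).
    exact: (s2valP' (cid2 (bx x)) j).
  have cb : (\sum_(x <- S) b x j)%:E @[j --> \oo] --> (\sum_(x <- S) diss_term K m (f `|tau|) x)%:E.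
    apply: cvg_EFin; first exact: nearW.
    exact: cvg_sum_seq.
  rewrite -(cvg_limn_einf_sup cb).1; apply: le_limn_einf => j.
  apply: (@le_trans _ _ (w j (i j))%:E); first by rewrite lee_fin; apply: ler_sum => x _.
  rewrite /G (big_rem (i j))/=; last by rewrite mem_iota add0n ilt.
  by rewrite indicE mem_set// mule1 leeDl// sume_ge0.
rewrite -EFinD; apply: le_trans (limn_einf_le intG).
have F : (\int[lebesgue_measure]_(tau in `[s, t]) limn_einf (G ^~ tau) <=
    limn_einf (fun j => \int[lebesgue_measure]_(tau in `[s, t]) G j tau))%E.
  by apply: fatou; [exact: mD|exact: mG|move=> j tau _; exact: G0].
apply: le_trans F.
apply: ge0_le_integral.
- exact: mD.
- by move=> tau _; rewrite lee_fin sumr_ge0// => x _; exact: diss_term_ge0.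
- apply/measurable_EFinP; apply: measurable_sum => x; apply: measurable_funTS.
  exact: measurable_diss_term.
(* Measurability of the lower limit is obtained from that of the upper limit of the negatives. *)
- have mGN j : measurable_fun `[s, t] (fun tau : R => - G j tau)%E.
    exact: measurableT_comp (mG j).
  exact: measurableT_comp (measurable_fun_limn_esup mGN).
- exact: key.
Unshelve. all: by end_near. Qed.

Lemma entropy_inequality (s t : R) : 0 <= s -> s <= t -> prob_vec (f 0) ->
  (rel_entropy (f t) m
     + \int[lebesgue_measure]_(tau in `[s, t]) dissipation K (f tau)
   <= rel_entropy (f s) m)%E.
Proof.
move=> s0 st p0; have ps := solution_prob p0 s0.
have t0 := le_trans s0 st; have pt := solution_prob p0 t0.
rewrite !rel_entropyE//.
have [[fs0 _ _] [ft0 _ _]] := (ps, pt).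
have es0 k := entropy_term_ge0 m_gt0 (fs0 k).
have et0 k := entropy_term_ge0 m_gt0 (ft0 k).
have [->|Hfin] := eqVneq (esumT (entropy_term m (f s))) +oo%E; first exact: leey.
have sH : summ (entropy_term m (f s)).
  rewrite /summ (_ : (fun k => _) = entropy_term m (f s)) ?ltey//.
  by apply/funext => k; rewrite ger0_norm.
move: st; rewrite le_eqVlt => /predU1P[<-|st].
  by rewrite set_itv1 integral_set1 adde0.
set J := (\int[_]_(_ in _) _)%E.
have JE : J = (\int[lebesgue_measure]_(tau in `[s, t]) esumT (diss_term K m (f `|tau|)))%E.
  apply: eq_integral => tau; rewrite inE/= in_itv/= => /andP[stau _].
  have tau0 := le_trans s0 stau; have [p _ _] := solution_prob p0 tau0.
  by rewrite (dissipationE K_gt0 m_gt0 m_db)// ger0_norm.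
have J0 : (0 <= J)%E.
  by rewrite JE; apply: integral_ge0 => tau _; apply: esumT_ge0 => x; exact: diss_term_ge0.
have JA A : uniq A ->
    (J <= (rsum (entropy_term m (f s)) - \sum_(k <- A) entropy_term m (f t) k)%:E)%E.
  move=> uA; rewrite JE; apply: integral_esumT_le => //.
  - by move=> tau x; exact: diss_term_ge0.
  - by move=> x; apply: measurable_funTS; exact: measurable_diss_term.
  - by move=> S uS; exact: entropy_dissipation_bound.
(* The empty list bounds the integral by the finite entropy at time [s], so [J] can be moved across
   before the supremum over [A] is taken. *)
have Jfin : J \is a fin_num.
  by rewrite ge0_fin_numE//; apply: le_lt_trans (JA [::] isT) (ltry _).
rewrite -leeBrDr// -(rsum_ge0E es0 sH); apply: esumT_le => A uA.
rewrite leeBrDr// -leeBrDl// -EFinB; exact: JA.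
Qed.

End EntropyInequality.

(** * Positivity of equilibria and reduction to ell_1 *)

Lemma prob1_prob_vec (R : realType) (g : int -> R) : prob1 g -> prob_vec g.
Proof.
move=> [g0 g1]; have sg : summ g.
  rewrite /summ (_ : (fun k => _) = g); first by rewrite /esumT g1 ltry.
  by apply/funext => k; rewrite ger0_norm.
by split => //; apply: EFin_inj; rewrite rsum_ge0E.
Qed.

(** Detailed balance at [l = k + 1] equates a positive multiple of [g k ^+ 2] with one of
    [g (k + 1) * g (k - 1)], so positivity spreads to both neighbours; unit mass provides a starting
    point. *)
Lemma detailed_balance_gt0 (R : realType) (K : int -> int -> R) (g : int -> R) :
  (forall k l, 0 < K k l) -> prob1 g -> detailed_balance K g ->
  forall k, 0 < g k.
Proof.
move=> K0 pg db; have [g0 sg g1] := prob1_prob_vec pg.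
have step k : 0 < g k -> 0 < g (k + 1) /\ 0 < g (k - 1).
  move=> gk; have := db k (k + 1); rewrite addrK => E.
  have : 0 < K (k + 1) (k - 1) * g (k + 1) * g (k - 1) by rewrite -E !mulr_gt0.
  have [g1k|g1k] := ltP 0 (g (k + 1)); last first.
    by rewrite (_ : g (k + 1) = 0) ?mulr0 ?mul0r ?ltxx//; apply/eqP; rewrite eq_le g1k g0.
  by rewrite pmulr_rgt0 ?mulr_gt0.
have [[k gk]|ng] := pselect (exists k, 0 < g k); last first.
  suff : rsum g = 0 by rewrite g1 => /eqP; rewrite oner_eq0.
  rewrite -[RHS](@rsum0 _ int); apply: eq_rsum => k; apply/eqP.
  by rewrite eq_le g0 andbT leNgt; apply/negP => gk; apply: ng; exists k.
have up (n : nat) : 0 < g (k + n%:Z) /\ 0 < g (k - n%:Z).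
  elim: n => [|n [IH1 IH2]]; first by rewrite oppr0 addr0.
  rewrite intS; split.
    by have [] := step _ IH1; rewrite -addrA (addrC n%:Z).
  by have [_] := step _ IH2; rewrite opprD -addrA (addrC (- n%:Z)).
move=> l; rewrite -(subrK k l) addrC; case: (l - k) => n; first by case: (up n).
by rewrite NegzE; case: (up n.+1).
Qed.

Lemma ell11_summ (R : realType) (g : int -> R) : ell11 g -> summ g.
Proof.
apply: le_lt_trans; apply: le_esum => k _; rewrite lee_fin ler_peMl// lerDl.
by rewrite ler0z.
Qed.

(** The weighted norm dominates the ell_1 norm, and multiplying by [s - t] removes the quotient. The
    point [s = t], absent from the punctured limit, is trivial. *)
Lemma C1_ell11_diff (R : realType) (u du : R -> int -> R) : C1_ell11 u du ->
  forall t : R, 0 <= t -> forall e : R, 0 < e -> exists2 d : R, 0 < d &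
  forall s : R, 0 <= s -> `|s - t| < d ->
    norm1 (fun k => u s k - u t k - (s - t) * du t k) <= e * `|s - t|.
Proof.
move=> C1 t t0 e e0; have [ut dut + _] := C1 t t0.
move=> /(_ [set x : \bar R | (x < e%:E)%E]) [|d d0 Hd].
  exact: (lt_nbhsl e0).
exists d => // s s0 std.
have [us _ _ _] := C1 s s0.
have sus := ell11_summ us; have sut := ell11_summ ut; have sdut := ell11_summ dut.
have [->|st] := eqVneq s t.
  rewrite subrr normr0 mulr0 (_ : norm1 _ = 0)//.
  by rewrite -[RHS](@rsum0 _ int); apply: eq_rsum => k; rewrite mul0r !subr0 subrr normr0.
have := Hd s; rewrite /ball_/= distrC => /(_ std st s0) H.
have st0 : s - t != 0 by rewrite subr_eq0.
rewrite (_ : (fun k => _) = fun k => (s - t) * ((u s k - u t k) / (s - t) - du t k)); last first.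
  by apply/funext => k; field.
have sq : summ (fun k => (u s k - u t k) / (s - t) - du t k).
  by apply/ell11_summ/(lt_trans H)/ltry.
rewrite norm1Z// mulrC ler_wpM2r// -lee_fin rsum_ge0E//; last exact: summ_norm.
apply: le_trans (ltW H); apply: le_esum => k _; rewrite lee_fin ler_peMl// lerDl.
by rewrite ler0z.
Qed.

Theorem corollary6p10 (R : realType) (K : int -> int -> R)
    (K_gt0 : forall k l, 0 < K k l)
    (K_bounded : exists2 CK : R, 0 < CK & forall k l, K k l <= CK)
    (K_db : exists2 g : int -> R, (forall k, 0 < g k) & detailed_balance K g)
    (Lp Lm : \bar R) (Lp_gt0 : (0 < Lp)%E) (Lm_gt0 : (0 < Lm)%E)
    (cvg_Lp : (K n%:Z 0 / K 1 (n%:Z - 1))%:E @[n --> \oo] --> Lp)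
    (cvg_Lm : (K 0 (- n%:Z) / K (- n%:Z + 1) (-1))%:E @[n --> \oo] --> Lm)
    (L_nonempty : let kappa := Num.sqrt (K 1 (-1) / K 0 0) in
      [set x : R | ((Lm * kappa%:E)^-1 < x%:E < Lp * kappa%:E)%E] !=set0)
    (f0 : int -> R) (f0_prob11 : prob11 f0)
    (f : R -> int -> R) (f_sol : is_solution K f0 f)
    (fs : int -> R) (fs_eq : is_db_equilibrium K fs) :
  (forall s t : R, 0 <= s -> s <= t ->
    (rel_entropy (f t) fs
       + \int[lebesgue_measure]_(tau in `[s, t]) dissipation K (f tau)
     <= rel_entropy (f s) fs)%E)
  /\ ((rel_entropy f0 fs < +oo)%E ->
      (forall t : R, 0 <= t -> (0 <= rel_entropy (f t) fs < +oo)%E) /\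
      (forall s t : R, 0 <= s -> s <= t ->
         (rel_entropy (f t) fs <= rel_entropy (f s) fs)%E)).
Proof.
have [C _ K_le] := K_bounded.
have [pfs _ fs_db] := fs_eq.
have [fs0 sfs fs1] := prob1_prob_vec pfs.
have fs_gt0 := detailed_balance_gt0 K_gt0 pfs fs_db.
have [df [C1 f_eq f0E]] := f_sol.
have sf t : 0 <= t -> summ (f t) by move=> /C1[/ell11_summ].
have sdf t : 0 <= t -> summ (df t) by move=> /C1[_ /ell11_summ].
have f_diff := C1_ell11_diff C1.
have p0 : prob_vec (f 0) by rewrite f0E; apply: prob1_prob_vec; case: f0_prob11.
have main s t (s0 : 0 <= s) (st : s <= t) :=
  entropy_inequality K_gt0 K_le fs_gt0 sfs fs1 fs_db sf sdf f_diff f_eq s0 st p0.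
have prob t (t0 : 0 <= t) := solution_prob K_gt0 K_le sf sdf f_diff f_eq p0 t0.
have int0 s t : 0 <= s ->
    (0 <= \int[lebesgue_measure]_(tau in `[s, t]) dissipation K (f tau))%E.
  move=> s0; apply: integral_ge0 => tau; rewrite /= in_itv/= => /andP[stau _].
  have [g0 _ _] := prob tau (le_trans s0 stau).
  rewrite (dissipationE K_gt0 fs_gt0 fs_db)//; apply: esumT_ge0 => x.
  exact: diss_term_ge0.
have mono s t : 0 <= s -> s <= t -> (rel_entropy (f t) fs <= rel_entropy (f s) fs)%E.
  by move=> s0 st; apply: le_trans (main s t s0 st); rewrite leeDl// int0.
split=> // Hfin; split=> // t t0; apply/andP; split.
  have pt := prob t t0; have [g0 _ _] := pt.
  by rewrite rel_entropyE//; apply: esumT_ge0 => k; exact: entropy_term_ge0.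
by apply: le_lt_trans (mono 0 t (lexx 0) t0) _; rewrite f0E.
Qed.
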